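(* Let $U\subset\mathbb{R}^2$ have Lebesgue measure $0<|U|\le 1$ and be canonically equivalent to a square. Let $1<a\le\infty$ and $1/a+1/b=1$. Then there exist $g,\gamma\in L^2(\mathbb{R})$ with $\|g\|_2=\|\gamma\|_2=1$ such that for every channel operator $\mathcal{H}$ whose spreading function $\Sigma_{\mathcal{H}}\in L^a(\mathbb{R}^2)$ is supported in $U$, and for every $\mu\in\mathbb{R}^2$, with $\lambda(\mu)=\langle S_\mu g,\mathcal{H}S_\mu\gamma\rangle$, $$\bigl\|\mathcal{H}S_\mu\gamma-\lambda(\mu)S_\mu g\bigr\|_2\ \le\ \|\Sigma_{\mathcal{H}}\|_a\cdot\Bigl(|U|-\operatorname{erf}\bigl(\sqrt{\pi|U|/4}\bigr)^2\Bigr)^{1/\max(b,2)} .$$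
   Context: Inner products on $L^2(\mathbb{R})$ are conjugate-linear in the first argument. For $\mu=(\mu_1,\mu_2)\in\mathbb{R}^2$ the time-frequency shift operator is $(S_\mu f)(t)=e^{i2\pi\mu_2 t}f(t-\mu_1)$. The cross ambiguity function is $A_{g\gamma}(\mu)=\langle g,S_\mu\gamma\rangle$. The channel operator $\mathcal{H}$ with spreading function $\Sigma_{\mathcal{H}}:\mathbb{R}^2\to\mathbb{C}$ is defined weakly by $\langle g,\mathcal{H}\gamma\rangle=\int_{\mathbb{R}^2}\Sigma_{\mathcal{H}}(\mu)A_{g\gamma}(\mu)\,d\mu$ for all $g,\gamma\in L^2(\mathbb{R})$. $\|\Sigma_{\mathcal{H}}\|_a$ is the $L^a(\mathbb{R}^2)$ norm. $U$ is canonically equivalent to a square if it is the image of an axis-parallel square under an affine canonical (symplectic) transformation of the plane, that is, $U=M\bigl([-s/2,s/2]^2\bigr)+c$ for some $s>0$, $M\in SL(2,\mathbb{R})$ and $c\in\mathbb{R}^2$ (so $|U|=s^2$). $\operatorname{erf}(x)=\frac{2}{\sqrt{\pi}}\int_0^x e^{-t^2}dt$. *)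

(* Defs.v *)
From mathcomp Require Import all_boot all_order all_algebra.
From mathcomp Require Import complex.
From mathcomp Require Import all_classical all_reals all_analysis.

Set Implicit Arguments.
Unset Strict Implicit.
Unset Printing Implicit Defensive.

Import Order.TTheory GRing.Theory Num.Theory.
Import numFieldNormedType.Exports.

Local Open Scope classical_set_scope.
Local Open Scope ring_scope.
Local Open Scope complex_scope.

(* Complex-valued functions are plain functions into [R[i]]; elements of an   *)
(* L^p space are represented by measurable functions, not by a.e. classes.    *)

Definition cmeasurable (d : measure_display) (T : measurableType d)
    (R : realType) (f : T -> R[i]) : Prop :=
  measurable_fun [set: T] (fun x => complex.Re (f x)) /\
  measurable_fun [set: T] (fun x => complex.Im (f x)).

Definition cintegral (d : measure_display) (T : measurableType d)
    (R : realType) (mu : {measure set T -> \bar R}) (f : T -> R[i]) : R[i] :=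
  (\int[mu]_x complex.Re (f x)) +i* (\int[mu]_x complex.Im (f x)).

Definition cLnorm (d : measure_display) (T : measurableType d)
    (R : realType) (mu : {measure set T -> \bar R}) (p : \bar R)
    (f : T -> R[i]) : \bar R :=
  ('N[mu]_p [EFin \o (fun x => ComplexField.Normc.normc (f x))])%E.

Definition cLp (d : measure_display) (T : measurableType d)
    (R : realType) (mu : {measure set T -> \bar R}) (p : \bar R)
    (f : T -> R[i]) : Prop :=
  cmeasurable f /\ (cLnorm mu p f < +oo)%E.

Definition leb (R : realType)
    : {measure set (measurableTypeR R) -> \bar R} := lebesgue_measure.

Definition leb2 (R : realType)
    : {measure set (measurableTypeR R * measurableTypeR R)%type -> \bar R} :=
  (lebesgue_measure \x lebesgue_measure)%E.

Definition L2 (R : realType) (f : R -> R[i]) : Prop := cLp (leb R) 2%:E f.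

Definition L2norm (R : realType) (f : R -> R[i]) : \bar R :=
  cLnorm (leb R) 2%:E f.

Definition inner (R : realType) (f g : R -> R[i]) : R[i] :=
  cintegral (leb R) (fun t => (f t)^* * g t).

Definition tfshift (R : realType) (mu : R * R) (f : R -> R[i]) : R -> R[i] :=
  fun t => (cos (2 * pi * mu.2 * t) +i* sin (2 * pi * mu.2 * t))
           * f (t - mu.1).

Definition cross_ambiguity (R : realType) (g gamma : R -> R[i])
    (mu : R * R) : R[i] :=
  inner g (tfshift mu gamma).

(* For [Sigma] integrable the integral converges absolutely, because the      *)
(* cross ambiguity function of two L^2 functions is bounded and continuous.   *)
(* This covers every L^p spreading function (p >= 1) that vanishes almost     *)
(* everywhere outside a set of finite measure.                                *)
Definition channel_operator (R : realType) (Sigma : R * R -> R[i])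
    (H : (R -> R[i]) -> (R -> R[i])) : Prop :=
  (forall gamma, L2 gamma -> L2 (H gamma)) /\
  (forall g gamma, L2 g -> L2 gamma ->
     inner g (H gamma) =
       cintegral (leb2 R) (fun mu => Sigma mu * cross_ambiguity g gamma mu)).

Definition supported_in (R : realType) (Sigma : R * R -> R[i])
    (U : set (R * R)) : Prop :=
  {ae leb2 R, forall mu, ~ U mu -> Sigma mu = 0}.

Definition linear_act (R : realType) (M : 'M[R]_2) (x : R * R) : R * R :=
  (M 0 0 * x.1 + M 0 1 * x.2, M 1 0 * x.1 + M 1 1 * x.2).

Definition canonically_equivalent_to_square (R : realType)
    (U : set (R * R)) : Prop :=
  exists (s : R) (M : 'M[R]_2) (c : R * R),
    [/\ 0 < s, \det M = 1 &
        U = [set linear_act M x + c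
            | x in `[- (s / 2), s / 2] `*` `[- (s / 2), s / 2]]].

(* The difference is the oriented integral from 0 to x: one of the two        *)
(* intervals is always empty or {0}.                                          *)
Definition erf (R : realType) (x : R) : R :=
  2 / Num.sqrt pi *
  ((\int[leb R]_(t in `[0, x]) expR (- t ^+ 2))
   - (\int[leb R]_(t in `[x, 0]) expR (- t ^+ 2))).

(* Main.v *)
Require Import Defs.
From mathcomp Require Import all_boot all_order all_algebra.
From mathcomp Require Import complex.
From mathcomp Require Import all_classical all_reals all_analysis.
From mathcomp Require Import measurable_realfun ess_sup_inf.
From mathcomp Require Import ring lra.

Set Implicit Arguments.
Unset Strict Implicit.
Unset Printing Implicit Defensive.

Import Order.TTheory GRing.Theory Num.Theory.
Import numFieldNormedType.Exports.

Local Open Scope classical_set_scope.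
Local Open Scope ring_scope.
Local Open Scope complex_scope.

(* Write U = M [-s/2, s/2]^2 + c with M in SL(2), and take for gamma the Gaussian chirp
   (2 al)^(1/4) exp (- pi (al + i be) t^2) and g = S_c gamma. Choosing al and be from M,
   |<g, S_nu gamma>|^2 = exp (- pi |M^-1 (nu - c)|^2), so that the integral of
   1 - |<g, S_nu gamma>|^2 over U is |U| - erf (sqrt (pi |U| / 4))^2.

   For e = S_mu g, psi = S_mu gamma and h = H psi - <e, H psi> e, which is orthogonal to e,
   the weak definition of H gives |h|^2 = <h, H psi> = \int Sigma nu <h, S_nu psi>, and
   Bessel's inequality |<h, S_nu psi>|^2 <= |h|^2 (1 - |<e, S_nu psi>|^2) reduces the bound
   to Hoelder's inequality on U. *)

(** * Affine changes of variables on the line and in the plane *)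

(** The form |M^-1 x|^2 depends on M only through M M^T, so it ranges over the positive definite
    quadratic forms of determinant 1. The two parameters of a Gaussian chirp parametrise exactly
    these forms, so explicit chirps take the place of metaplectic operators. Shifting by c puts the
    maximum of the overlap at the centre of U, where the weight 1 - |<g, S_nu gamma>|^2 vanishes.
    Time-frequency shifts commute up to a phase of modulus 1. Hence |<S_mu g, S_nu S_mu gamma>| does
    not depend on mu, and one pair serves every mu. The overlap is only bounded from below, the
    direction that Bessel's inequality asks for. After a rotation by a constant phase its real part
    is a Gaussian cosine integral, which is computed by differentiation under the integral sign.
    Similarly, the integral of Sigma against the ambiguity function is estimated through a pointwise
    bound by a non-negative function of finite integral. *)

Section affine_line.
Variable R : realType.

Lemma measurable_affine (k c : R) :
  measurable_fun setT (fun x : R => k * x + c).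
Proof. by apply: measurable_funD => //; exact: measurable_funM. Qed.

(** The right-hand side is itself a measure in [A], so uniqueness of Lebesgue measure leaves only
    the half-open intervals to compare. *)
Lemma leb_preimage_affine (k c : R) (A : set R) : 0 < k -> measurable A ->
  leb R A = (k%:E * leb R ((fun x => (k * x + c)%R) @^-1` A))%E.
Proof.
move=> k0 mA.
have mf : measurable_fun setT
    ((fun x => k * x + c) : measurableTypeR R -> measurableTypeR R).
  exact: measurable_affine.
pose push : {measure set (measurableTypeR R) -> \bar R} :=
  pushforward (leb R)
    ((fun x => k * x + c) : measurableTypeR R -> measurableTypeR R).
pose m : {measure set (measurableTypeR R) -> \bar R} :=
  mscale (NngNum (ltW k0)) (push mf).
apply: (@lebesgue_measure_unique R m) => // _ [[a b]] _ <-.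
rewrite -[RHS]/(k%:E * leb R ((fun x => (k * x + c)%R) @^-1` `]a, b]))%E.
have -> : (fun x => k * x + c) @^-1` `]a, b] =
    `](a - c) / k, (b - c) / k]%classic :> set R.
  apply/seteqP; split => x /=; rewrite !in_itv/= ltr_pdivrMr// ler_pdivlMr//
    ltrBlDr lerBrDr (mulrC x) => /andP[-> ->]//.
rewrite /leb /= !lebesgue_measure_itv/= !lte_fin ltr_pM2r ?invr_gt0// ltrD2r.
case: ifPn => _; rewrite ?mule0// -!EFinB -EFinM; congr EFin.
by field; rewrite gt_eqF.
Qed.

Lemma ge0_integral_affine (k c : R) (f : R -> \bar R) : 0 < k ->
  measurable_fun setT f -> (forall x, 0 <= f x)%E ->
  (\int[leb R]_x f x = k%:E * \int[leb R]_x f (k * x + c)%R)%E.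
Proof.
move=> k0 mf f0.
pose F := (fun x => k * x + c) : measurableTypeR R -> measurableTypeR R.
have mF : measurable_fun setT F by exact: measurable_affine.
rewrite -(@ge0_integral_pushforward _ _ _ _ _ F mF (leb R) setT f)//.
pose push : {measure set (measurableTypeR R) -> \bar R} := pushforward (leb R) F.
rewrite -(@ge0_integral_mscale _ _ R (push mF) setT measurableT (NngNum (ltW k0)))//.
by apply: eq_measure_integral => A mA _; exact: leb_preimage_affine.
Qed.

Lemma integrable_affine (k c : R) (f : R -> R) : 0 < k ->
  (leb R).-integrable setT (EFin \o f) ->
  (leb R).-integrable setT (EFin \o (fun x => f (k * x + c))).
Proof.
move=> k0 /integrableP[/measurable_EFinP mf foo].
have mfk : measurable_fun setT (fun x => f (k * x + c)).
  exact: (measurableT_comp mf (measurable_affine k c)).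
apply/integrableP; split; first exact/measurable_EFinP.
move: foo; rewrite (ge0_integral_affine c k0 (f := fun x => `|(f x)%:E|%E))//; last first.
  by apply: measurableT_comp => //; exact/measurable_EFinP.
rewrite muleC => foo; rewrite ltey; apply/eqP => oo; move: foo.
by rewrite /= in oo *; rewrite oo gt0_mulye ?lte_fin.
Qed.

Lemma Rintegral_affine (k c : R) (f : R -> R) : 0 < k ->
  (leb R).-integrable setT (EFin \o f) ->
  \int[leb R]_x f x = k * \int[leb R]_x f (k * x + c).
Proof.
move=> k0 fi; have fki := integrable_affine c k0 fi.
have mf := measurable_int _ fi; have mfk := measurable_int _ fki.
(* Both parts have finite integrals, so the factor [k] distributes over their difference. *)
have Hp := integrable_pos_fin_num measurableT fki.
have Hn := integrable_neg_fin_num measurableT fki.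
rewrite /Rintegral integralE [in RHS]integralE.
rewrite (ge0_integral_affine c k0 (f := ((EFin \o f)^\+)%E))//; last exact: measurable_funepos.
rewrite (ge0_integral_affine c k0 (f := ((EFin \o f)^\-)%E))//; last exact: measurable_funeneg.
move: Hp Hn; set P := (\int[leb R]_x _^\+ x)%E; set N := (\int[leb R]_x _^\- x)%E => Hp Hn.
have -> : (\int[leb R]_x (EFin \o f)^\+ (k * x + c)%R = P)%E.
  by apply: eq_integral => x _; rewrite !funeposE.
have -> : (\int[leb R]_x (EFin \o f)^\- (k * x + c)%R = N)%E.
  by apply: eq_integral => x _; rewrite !funenegE.
by rewrite -(fineK Hp) -(fineK Hn) -!EFinM -!EFinB/= mulrBr.
Qed.

End affine_line.

(** * Area-preserving maps: shears, SL(2) and translations *)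

Section plane.
Variable R : realType.
Local Notation plane := (measurableTypeR R * measurableTypeR R)%type.

Definition measure_preserving2 (f : R * R -> R * R) : Prop :=
  measurable_fun (setT : set plane) (f : plane -> plane) /\
  forall A : set plane, measurable A -> leb2 R (f @^-1` A) = leb2 R A.

Lemma measure_preserving2_comp (f g : R * R -> R * R) :
  measure_preserving2 f -> measure_preserving2 g -> measure_preserving2 (f \o g).
Proof.
move=> [mf fE] [mg gE]; split; first exact: (measurableT_comp mf mg).
move=> A mA; rewrite comp_preimage gE ?fE//.
by rewrite -[X in measurable X]setTI; exact: mf.
Qed.

Lemma leb_preimage_addr (c : R) (A : set R) : measurable A ->
  leb R ((fun x => x + c) @^-1` A) = leb R A.
Proof.
move=> mA; rewrite (leb_preimage_affine c ltr01 mA) mul1e.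
by congr (leb R (_ @^-1` A)); apply/funext => x; rewrite mul1r.
Qed.

Lemma measurable_fun_plane (f1 f2 : plane -> R) :
  measurable_fun setT f1 -> measurable_fun setT f2 ->
  measurable_fun setT ((fun x => (f1 x, f2 x)) : plane -> plane).
Proof. by move=> m1 m2; exact: measurable_fun_pair. Qed.

(** On each vertical line the map is a translation by [h x], and the product measure integrates the
    lengths of the vertical sections. *)
Lemma measure_preserving2_yshear (h : R -> R) : measurable_fun setT h ->
  measure_preserving2 (fun x => (x.1, x.2 + h x.1)).
Proof.
move=> mh.
have mf : measurable_fun setT ((fun x => (x.1, x.2 + h x.1)) : plane -> plane).
  apply: measurable_fun_plane => //; apply: measurable_funD => //.
  exact: measurableT_comp.
split=> // A mA.
rewrite /leb2 /product_measure1; apply: eq_integral => x _ /=.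
rewrite -[RHS](leb_preimage_addr (h x)); last exact: measurable_xsection.
congr (lebesgue_measure _); apply/seteqP; split => y /=;
  by rewrite /xsection /= !inE.
Qed.

(** [leb2] is built from vertical sections; horizontal shears call for the horizontal ones. *)
Lemma leb2E (A : set plane) : measurable A ->
  leb2 R A = (\int[leb R]_y leb R (ysection A y))%E.
Proof.
move=> mA.
rewrite -[RHS]/((leb R \x^ leb R)%E A).
apply: product_measure_unique => // B C mB mC.
exact: product_measure2E.
Qed.

Lemma measure_preserving2_xshear (h : R -> R) : measurable_fun setT h ->
  measure_preserving2 (fun x => (x.1 + h x.2, x.2)).
Proof.
move=> mh.
have mf : measurable_fun setT ((fun x => (x.1 + h x.2, x.2)) : plane -> plane).
  apply: measurable_fun_plane => //; apply: measurable_funD => //.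
  exact: measurableT_comp.
split=> // A mA.
rewrite !leb2E//; last by rewrite -[X in measurable X]setTI; exact: mf.
apply: eq_integral => y _ /=.
rewrite -[RHS](leb_preimage_addr (h y)); last exact: measurable_ysection.
congr (leb R _); apply/seteqP; split => x /=;
  by rewrite /ysection /= !inE.
Qed.

(** For [r != 0] the matrix is a product of three shears, with entries (p - 1) / r, r and (t - 1) /
    r. If [r = 0] then [p != 0]: adding the first row to the second gives the previous case, and a
    vertical shear undoes the addition. *)
Lemma measure_preserving2_linear (p q r t : R) : p * t - q * r = 1 ->
  measure_preserving2 (fun x => (p * x.1 + q * x.2, r * x.1 + t * x.2)).
Proof.
wlog r0 : p q r t / r != 0 => [wlg|] pt1.
  have [r0|] := eqVneq r 0; last by move=> r0; exact: wlg.
  have p0 : p != 0.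
    by apply/eqP => p0; move/eqP: pt1; rewrite r0 p0 mul0r mulr0 subrr eq_sym oner_eq0.
  have := @wlg p q (r + p) (t + q).
  rewrite r0 add0r => /(_ p0) => /(_ _)/wrap[|H].
    by rewrite -pt1 r0; ring.
  have mN : measurable_fun setT (fun x : R => -1 * x) by exact: measurable_funM.
  have := measure_preserving2_comp (measure_preserving2_yshear mN) H.
  by congr measure_preserving2; apply/funext => x /=; congr pair; ring.
have mM (k : R) : measurable_fun setT (fun x : R => k * x) by exact: measurable_funM.
have H1 := measure_preserving2_xshear (mM ((p - 1) / r)).
have H2 := measure_preserving2_yshear (mM r).
have H3 := measure_preserving2_xshear (mM ((t - 1) / r)).
have := measure_preserving2_comp H1 (measure_preserving2_comp H2 H3).
congr measure_preserving2; apply/funext => x /=; congr pair; last by field.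
have -> : q = (p * t - 1) / r by rewrite -pt1; field.
by field.
Qed.

Lemma measure_preserving2_translation (c : R * R) :
  measure_preserving2 (fun x => x - c).
Proof.
have mc (k : R) : measurable_fun setT (cst k : R -> R) by exact: measurable_cst.
have H1 := measure_preserving2_xshear (mc (- c.1)).
have H2 := measure_preserving2_yshear (mc (- c.2)).
have := measure_preserving2_comp H1 H2.
by congr measure_preserving2; apply/funext => -[x y] /=.
Qed.

Lemma ge0_integral_measure_preserving2 (f : R * R -> R * R) (D : set (R * R))
    (F : plane -> \bar R) :
  measure_preserving2 f -> measurable (D : set plane) ->
  measurable_fun setT F -> (forall x, 0 <= F x)%E ->
  (\int[leb2 R]_(x in f @^-1` D) F (f x) = \int[leb2 R]_(x in D) F x)%E.
Proof.
move=> [mf fE] mD mF F0.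
have F0' : {in D, forall y, (0 <= F y)%E} by move=> y _.
have mF' : measurable_fun (D : set plane) F by exact: measurable_funTS.
have H := @ge0_integral_pushforward _ _ plane plane R f mf (leb2 R) D F mD mF' F0'.
etransitivity; first exact: esym H.
by apply: eq_measure_integral => A mA _; exact: fE.
Qed.

End plane.

(** * The Fourier transform of the Gaussian *)

Section gaussian.
Variable R : realType.
Local Notation mu := (leb R).

Lemma integrable_gauss (a : R) : 0 < a ->
  mu.-integrable setT (EFin \o (fun x => expR (- (a * x ^+ 2)))).
Proof.
move=> a0; have sa0 : 0 < Num.sqrt a by rewrite sqrtr_gt0.
have := integrable_affine 0 sa0 (@integrableT_gauss R).
congr integrable; apply/funext => x /=.
by rewrite /gauss_fun addr0 exprMn sqr_sqrtr// ltW.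
Qed.

Lemma Rintegral_gauss (a : R) : 0 < a ->
  \int[mu]_x expR (- (a * x ^+ 2)) = Num.sqrt (pi / a).
Proof.
move=> a0; have sa0 : 0 < Num.sqrt a by rewrite sqrtr_gt0.
have := Rintegral_affine 0 sa0 (@integrableT_gauss R).
rewrite [LHS](_ : _ = Num.sqrt pi); last first.
  by rewrite /Rintegral (@integralT_gauss R).
under eq_Rintegral do rewrite /gauss_fun addr0 exprMn sqr_sqrtr ?(ltW a0)//.
move=> H; rewrite sqrtrM ?pi_ge0// H sqrtrV ?ltW//.
by rewrite mulrAC mulfV ?gt_eqF// mul1r.
Qed.

Lemma integrable_gauss_bound (f : R -> R) (C a : R) : 0 < a ->
  measurable_fun setT f -> (forall x, `|f x| <= C * expR (- (a * x ^+ 2))) ->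
  mu.-integrable setT (EFin \o f).
Proof.
move=> a0 mf fC.
apply: (@le_integrable _ _ _ mu setT measurableT _ (EFin \o (fun x => C * expR (- (a * x ^+ 2))))) => //.
- exact/measurable_EFinP.
- move=> x _ /=; rewrite lee_fin (le_trans (fC x))// ler_norm//.
- have := @integrableZl _ _ _ mu setT measurableT C _ (integrable_gauss a0).
  by congr integrable.
Qed.

Lemma is_derive_addl (c s : R) : is_derive s (1 : R) (fun s => c + s) 1.
Proof.
have : is_derive s (1 : R) (cst c + id : R -> R) 1.
  by apply: is_derive_eq; rewrite add0r.
by [].
Qed.

Lemma is_derive_mull (c s : R) : is_derive s (1 : R) (fun s => c * s) c.
Proof.
have : is_derive s (1 : R) (c *: (id : R -> R)) c.
  by apply: is_derive_eq; rewrite [LHS]mulr1.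
by [].
Qed.

Lemma is_derive_sqr (s : R) : is_derive s (1 : R) (fun s => s ^+ 2) (2 * s).
Proof.
have : is_derive s (1 : R) ((id : R -> R) ^+ 2) (2 * s).
  by apply: is_derive_eq; rewrite expr1 [LHS]mulr1.
by [].
Qed.

(* By translation invariance [s |-> \int h (x + s)] is constant. *)
Lemma Rintegral_derive_eq0 (h h' G : R -> R) :
  (forall x : R, is_derive x (1 : R) h (h' x)) ->
  mu.-integrable setT (EFin \o h) -> mu.-integrable setT (EFin \o G) ->
  (forall x s, `|s| < 1 -> `|h' (x + s)| <= G x) ->
  \int[mu]_x h' x = 0.
Proof.
move=> dh ih iG hG.
pose f (s x : R) := h (x + s).
have df (s x : R) : is_derive s (1 : R) (f ^~ x) (h' (x + s)).
  have dx := is_derive_addl x s.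
  have := @is_derive1_comp R h (fun s => x + s) s _ _ (dh (x + s)) dx.
  by rewrite mulr1.
have G0 y : 0 <= G y.
  by apply: le_trans (hG y 0 _); rewrite ?normr0.
have I0 : `](-1), 1[%classic (0 : R) by rewrite /= in_itv/= ltrN10 ltr01.
have intf (s : R) : `](-1), 1[%classic s -> mu.-integrable setT (EFin \o f s).
  move=> _; have := integrable_affine s ltr01 ih.
  by congr integrable; apply/funext => x /=; rewrite mul1r.
have d1E (s y : R) : partial1of2 f s y = h' (y + s).
  by rewrite partial1of2E; apply: derive_val.
have := @differentiation_under_integral R _ _ mu f setT measurableT 0 (-1) 1 I0 intf
  (fun s y _ _ => @ex_derive _ _ _ _ _ _ _ (df s y)) G G0 iG.
rewrite (_ : (fun x' : R => _) = cst (\int[mu]_x h x)); last first.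
  apply/funext => s; rewrite (Rintegral_affine s ltr01 ih) mul1r.
  by apply: eq_Rintegral => x _; rewrite /f mul1r.
rewrite derive1_cst => H.
rewrite [RHS]H; last first.
  move=> s y /=; rewrite in_itv/= => s1 _; rewrite d1E hG// ltr_norml//.
by apply: eq_Rintegral => x _; rewrite d1E addr0.
Qed.

(** This is the real part of exp (- (x - i k)^2). The Cauchy-Riemann equations then make its
    [k]-derivative [dchi] equal to the [x]-derivative of the imaginary part, which is how the shift
    of the contour is carried out with real integrals. *)
Let chi (k x : R) := expR (k ^+ 2 - x ^+ 2) * cos (2 * k * x).
Let dchi (k x : R) :=
  expR (k ^+ 2 - x ^+ 2) * (2 * k * cos (2 * k * x) - 2 * x * sin (2 * k * x)).


Lemma measurable_cos_comp d (T : measurableType d) (f : T -> R) :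
  measurable_fun setT f -> measurable_fun setT (fun x => cos (f x)).
Proof.
have mc : measurable_fun setT (@cos R).
  by apply: continuous_measurable_fun; exact: continuous_cos.
by move=> mf; exact: measurableT_comp mc mf.
Qed.

Lemma measurable_sin_comp d (T : measurableType d) (f : T -> R) :
  measurable_fun setT f -> measurable_fun setT (fun x => sin (f x)).
Proof.
have mc : measurable_fun setT (@sin R).
  by apply: continuous_measurable_fun; exact: continuous_sin.
by move=> mf; exact: measurableT_comp mc mf.
Qed.

Let measurable_sqr (c : R) : measurable_fun setT (fun x : R => c - x ^+ 2).
Proof. by apply: measurable_funB => //; exact: measurable_funX. Qed.

Let measurable_chi k : measurable_fun setT (chi k).
Proof.
apply: measurable_funM; first exact: measurableT_comp.
by apply: measurable_cos_comp; exact: measurable_funM.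
Qed.

Let is_derive_chi k x : is_derive k (1 : R) (chi ^~ x) (dchi k x).
Proof.
have d1 : is_derive k (1 : R) ((fun k => k ^+ 2 : R) - cst (x ^+ 2)) (2 * k - 0).
  exact: is_deriveB (is_derive_sqr k) _.
have d2 := @is_derive1_comp R expR _ k _ _ (is_derive_expR _) d1.
have d3 := @is_derive1_comp R cos _ k _ _ (is_derive_cos _) (is_derive_mull (2 * x) k).
have H := is_deriveM d2 d3.
suff -> : chi ^~ x = ((expR \o ((fun k => k ^+ 2 : R) - cst (x ^+ 2))) *
    (cos \o ( *%R (2 * x)))).
  apply: is_derive_eq H _.
  rewrite /dchi /= /GRing.scale/= subr0 mulrAC /cst/=.
  by rewrite fctE (_ : 2 * k * x = 2 * x * k); ring.
by apply/funext => y; rewrite /chi /= fctE /= mulrAC.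
Qed.

(* [dchi] is also an [x]-derivative, so its integral over the line vanishes. *)
Let is_derive_dual_chi k x :
  is_derive x (1 : R) (fun x => expR (k ^+ 2 - x ^+ 2) * sin (2 * k * x)) (dchi k x).
Proof.
have d1 : is_derive x (1 : R) (cst (k ^+ 2) - (fun x => x ^+ 2 : R)) (0 - 2 * x).
  exact: is_deriveB _ (is_derive_sqr x).
have d2 := @is_derive1_comp R expR _ x _ _ (is_derive_expR _) d1.
have d3 := @is_derive1_comp R sin _ x _ _ (is_derive_sin _) (is_derive_mull (2 * k) x).
apply: is_derive_eq (is_deriveM d2 d3) _.
by rewrite /dchi /= /GRing.scale/= /cst/= fctE; ring.
Qed.

(** Half of the Gaussian decay absorbs the factor |x|, since |x| <= 1 + x^2 / 2 <= exp (x^2 / 2);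
    the other half remains as an integrable bound. *)
Let dchi_le k x : `|dchi k x| <=
  (2 * `|k| + 2) * expR (k ^+ 2) * expR (- (2^-1 * x ^+ 2)).
Proof.
have xE : `|x| * expR (- (2^-1 * x ^+ 2)) <= 1.
  rewrite expRN ler_pdivrMr ?expR_gt0// mul1r.
  apply: le_trans (expR_ge1Dx _); rewrite -(real_normK (num_real x)).
  by have := sqr_ge0 (`|x| - 1); lra.
have E1 : expR (- (2^-1 * x ^+ 2)) <= 1.
  by rewrite -expR0 ler_expR oppr_le0 mulr_ge0// sqr_ge0.
have E0 := expR_ge0 (- (2^-1 * x ^+ 2)).
have -> : dchi k x = expR (k ^+ 2) * expR (- (2^-1 * x ^+ 2)) *
    (expR (- (2^-1 * x ^+ 2)) * (2 * k * cos (2 * k * x) - 2 * x * sin (2 * k * x))).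
  by rewrite mulrA -!expRD /dchi; congr (expR _ * _); field.
rewrite normrM ger0_norm; last by rewrite mulr_ge0 ?expR_ge0.
rewrite (mulrC (2 * _ + 2)) -!mulrA ler_pM2l ?expR_gt0//.
rewrite (mulrC (2 * _ + 2)) ler_pM2l ?expR_gt0//.
rewrite normrM (ger0_norm E0).
apply: (@le_trans _ _ (expR (- (2^-1 * x ^+ 2)) * (2 * `|k| + 2 * `|x|))).
  rewrite ler_pM2l ?expR_gt0// (le_trans (ler_normB _ _))//.
  rewrite !(normrM 2) (ger0_norm (ler0n _ 2)) lerD// ler_pM2l// normrM ler_piMr//.
    by rewrite ler_norml cos_geN1 cos_le1.
  by rewrite ler_norml sin_geN1 sin_le1.
rewrite mulrDr lerD//.
  by rewrite ler_piMl// mulr_ge0.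
by rewrite mulrCA (mulrC (expR _)) ler_piMr.
Qed.

Let Rintegral_dchi k : \int[mu]_x dchi k x = 0.
Proof.
pose C := (2 * `|k| + 2) * expR (k ^+ 2).
have C0 : 0 <= C by rewrite mulr_ge0 ?expR_ge0// addr_ge0// mulr_ge0.
(* For |s| < 1 one has (x + s)^2 / 2 >= x^2 / 4 - 1, from (x + 2 s)^2 >= 0. The shift therefore
   costs half of the exponent and a factor e. *)
apply: (Rintegral_derive_eq0 (G := fun x => C * expR 1 * expR (- (4^-1 * x ^+ 2)))
  (is_derive_dual_chi k)).
- apply: (integrable_gauss_bound (C := expR (k ^+ 2)) ltr01) => [|x].
    apply: measurable_funM; first exact: measurableT_comp.
    by apply: measurable_sin_comp; exact: measurable_funM.
  rewrite normrM ger0_norm ?expR_ge0// mul1r -expRD ler_piMr ?expR_ge0//.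
  by rewrite ler_norml sin_geN1 sin_le1.
- have a0 : 0 < 4^-1 :> R by rewrite invr_gt0.
  apply: (integrable_gauss_bound (C := C * expR 1) a0) => [|x].
    apply: measurable_funM => //; apply: measurableT_comp => //.
    by apply: measurableT_comp => //; apply: measurable_funM => //; exact: measurable_funX.
  by rewrite ger0_norm// !mulr_ge0 ?expR_ge0.
- move=> x s s1; apply: (le_trans (dchi_le _ _)).
  rewrite -/C -mulrA ler_wpM2l// -expRD ler_expR.
  have : s ^+ 2 <= 1 by rewrite -real_normK ?num_real// exprn_ile1// ltW.
  by have := sqr_ge0 (x + 2 * s); rewrite !sqrrD; lra.
Qed.

(* [k |-> expR (k ^+ 2) * \int expR (- x ^+ 2) * cos (2 * k * x)] has zero derivative. *)
Lemma Rintegral_gauss_cos (k : R) :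
  \int[mu]_x (expR (- x ^+ 2) * cos (2 * k * x)) = Num.sqrt pi * expR (- k ^+ 2).
Proof.
have ichi l : mu.-integrable setT (EFin \o chi l).
  apply: (integrable_gauss_bound (C := expR (l ^+ 2)) ltr01) => // x.
  rewrite normrM ger0_norm ?expR_ge0// mul1r -expRD ler_piMr ?expR_ge0//.
  by rewrite ler_norml cos_geN1 cos_le1.
have dF a : is_derive a (1 : R) (fun l => \int[mu]_x chi l x) 0.
  have Ia : `]a - 1, a + 1[%classic a by rewrite /= in_itv/=; lra.
  (* [m] bounds |l| on the whole window around [a], so the dominating function does not depend on
     [l]. *)
  pose m := `|a| + 1.
  pose C := (2 * m + 2) * expR (m ^+ 2).
  pose G (x : R) := C * expR (- (2^-1 * x ^+ 2)).
  have G0 y : 0 <= G y.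
    by rewrite !mulr_ge0 ?expR_ge0// addr_ge0 ?mulr_ge0 ?addr_ge0.
  have iG : mu.-integrable setT (EFin \o G).
    have a0 : 0 < 2^-1 :> R by rewrite invr_gt0.
    apply: (integrable_gauss_bound (C := C) a0) => [|x]; last by rewrite ger0_norm.
    apply: measurable_funM => //; apply: measurableT_comp => //.
    by apply: measurableT_comp => //; apply: measurable_funM => //; exact: measurable_funX.
  have d1E l y : partial1of2 chi l y = dchi l y.
    by rewrite partial1of2E; apply: derive_val.
  have Gub l y : `]a - 1, a + 1[%classic l -> setT y -> `|partial1of2 chi l y| <= G y.
    rewrite /= in_itv/= => /andP[l1 l2] _; rewrite d1E (le_trans (dchi_le _ _))//.
    rewrite ler_wpM2r ?expR_ge0//.
    have lm : `|l| <= m.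
      by rewrite -(subrK a l) (le_trans (ler_normD _ _))// addrC lerD2l ler_norml; lra.
    rewrite ler_pM ?expR_ge0//.
    - by rewrite lerD2r ler_pM2l.
    - by rewrite ler_expR -(real_normK (num_real l)) lerXn2r ?nnegrE// addr_ge0.
  have der l y (_ : `]a - 1, a + 1[%classic l) (_ : setT y) : derivable (chi ^~ y) l 1.
    exact: (@ex_derive _ _ _ _ _ _ _ (is_derive_chi l y)).
  apply: DeriveDef.
    exact: (derivable_under_integral measurableT Ia (fun l _ => ichi l) der G0 iG Gub).
  rewrite -derive1E (differentiation_under_integral measurableT Ia (fun l _ => ichi l) der G0 iG Gub).
  by rewrite -[RHS](Rintegral_dchi a); apply: eq_Rintegral => x _; rewrite d1E.
have := @is_derive_0_is_cst R (fun l => \int[mu]_x chi l x) k 0 dF.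
rewrite [X in _ = X -> _](_ : _ = Num.sqrt pi); last first.
  rewrite -[in RHS](divr1 pi) -(Rintegral_gauss ltr01).
  by apply: eq_Rintegral => x _; rewrite /chi mulr0 mul0r cos0 mulr1 expr0n/= sub0r mul1r.
move=> <-; rewrite [RHS]mulrC -RintegralZl//.
by apply: eq_Rintegral => x _; rewrite /chi mulrA -expRD addrA addNr add0r.
Qed.


Lemma Rintegral_gauss_cos_scaled (p q : R) : 0 < p ->
  \int[mu]_x (expR (- (p * x ^+ 2)) * cos (q * x)) =
  Num.sqrt (pi / p) * expR (- (q ^+ 2 / (4 * p))).
Proof.
move=> p0; have sp0 : 0 < Num.sqrt p by rewrite sqrtr_gt0.
have p2 : Num.sqrt p ^+ 2 = p by rewrite sqr_sqrtr// ltW.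
pose k := q / (2 * Num.sqrt p).
have i0 : mu.-integrable setT (EFin \o (fun x => expR (- x ^+ 2) * cos (2 * k * x))).
  apply: (integrable_gauss_bound (C := 1) ltr01) => [|x].
    apply: measurable_funM; last by apply: measurable_cos_comp; exact: measurable_funM.
    by apply: measurableT_comp => //; apply: measurableT_comp => //; exact: measurable_funX.
  by rewrite normrM ger0_norm ?expR_ge0// !mul1r ler_piMr ?expR_ge0// ler_norml cos_geN1 cos_le1.
have := Rintegral_affine 0 sp0 i0; rewrite Rintegral_gauss_cos.
have -> : k ^+ 2 = q ^+ 2 / (4 * p).
  rewrite /k expr_div_n exprMn p2; congr (_ / (_ * _)); ring.
under eq_Rintegral => x _.
  rewrite addr0 exprMn p2 (_ : 2 * k * (Num.sqrt p * x) = q * x); last first.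
    by rewrite /k; field; rewrite gt_eqF.
  over.
move=> H; rewrite sqrtrM ?pi_ge0// sqrtrV ?ltW// mulrAC H.
by rewrite mulrAC mulfV ?gt_eqF// mul1r.
Qed.

End gaussian.

(** * The inner product of [L2] functions *)

Section complex_parts.
Variable R : realType.
Implicit Types x y : R[i].

Lemma ReM x y :
  complex.Re (x * y) = complex.Re x * complex.Re y - complex.Im x * complex.Im y.
Proof. by case: x y => [a b] [c e]. Qed.

Lemma ImM x y :
  complex.Im (x * y) = complex.Re x * complex.Im y + complex.Im x * complex.Re y.
Proof. by case: x y => [a b] [c e]. Qed.

Lemma ReD x y : complex.Re (x + y) = complex.Re x + complex.Re y.
Proof. by case: x y => [a b] [c e]. Qed.

Lemma ImD x y : complex.Im (x + y) = complex.Im x + complex.Im y.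
Proof. by case: x y => [a b] [c e]. Qed.

Lemma ReJ x : complex.Re x^* = complex.Re x.
Proof. by case: x. Qed.

Lemma ImJ x : complex.Im x^* = - complex.Im x.
Proof. by case: x. Qed.

Lemma eq_complexP x y : complex.Re x = complex.Re y -> complex.Im x = complex.Im y -> x = y.
Proof. by case: x y => [a b] [c e] /= -> ->. Qed.

(** The squared modulus is kept as a real polynomial, so that identities and estimates fall to
    [ring] and [lra]; square roots enter only through [normcE]. *)
Definition nsq x : R := complex.Re x ^+ 2 + complex.Im x ^+ 2.

Lemma nsq_ge0 x : 0 <= nsq x.
Proof. by rewrite addr_ge0 ?sqr_ge0. Qed.

Lemma nsqM x y : nsq (x * y) = nsq x * nsq y.
Proof. by rewrite /nsq ReM ImM; ring. Qed.

Lemma normcE x : ComplexField.Normc.normc x = Num.sqrt (nsq x).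
Proof. by case: x. Qed.

Lemma Re_le_sqrt_nsq x : complex.Re x <= Num.sqrt (nsq x).
Proof.
apply: le_trans (ler_norm _) _.
by rewrite -sqrtr_sqr ler_wsqrtr// lerDl sqr_ge0.
Qed.

Lemma conjM_nsq x : x^* * x = (nsq x)%:C.
Proof. by case: x => [a b]; apply: eq_complexP; rewrite /nsq /=; ring. Qed.

Lemma realcM (a b : R) : (a * b)%:C = a%:C * b%:C :> R[i].
Proof. by apply: eq_complexP; rewrite /=; ring. Qed.

Lemma realcB (a b : R) : (a - b)%:C = a%:C - b%:C :> R[i].
Proof. by apply: eq_complexP; rewrite /=; ring. Qed.

End complex_parts.

(** * Integration of complex-valued functions *)

Section complex_integral.
Context d (T : measurableType d) (R : realType) (mu : {measure set T -> \bar R}).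
Implicit Types f g : T -> R[i].

Definition cintegrable f : Prop :=
  mu.-integrable setT (EFin \o (fun x => complex.Re (f x))) /\
  mu.-integrable setT (EFin \o (fun x => complex.Im (f x))).

Lemma integrable_addR (u v : T -> R) :
  mu.-integrable setT (EFin \o u) -> mu.-integrable setT (EFin \o v) ->
  mu.-integrable setT (EFin \o (fun x => u x + v x)).
Proof. by move=> iu iv; have := integrableD measurableT iu iv. Qed.

Lemma integrable_mulR (k : R) (u : T -> R) :
  mu.-integrable setT (EFin \o u) ->
  mu.-integrable setT (EFin \o (fun x => k * u x)).
Proof. by move=> iu; have := integrableZl measurableT k iu. Qed.

Lemma cintegralD f g : cintegrable f -> cintegrable g ->
  cintegral mu (fun x => f x + g x) = cintegral mu f + cintegral mu g.
Proof.
move=> [fr fi] [gr gi]; apply: eq_complexP => /=; rewrite -RintegralD//.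
  by apply: eq_Rintegral => x _; exact: ReD.
by apply: eq_Rintegral => x _; exact: ImD.
Qed.

Lemma cintegrableZ (c : R[i]) f : cintegrable f -> cintegrable (fun x => c * f x).
Proof.
move=> [fr fi]; split.
  rewrite [X in EFin \o X](_ : _ = fun x => complex.Re c * complex.Re (f x)
      + - complex.Im c * complex.Im (f x)); last first.
    by apply/funext => x; rewrite ReM mulNr.
  by apply: integrable_addR; exact: integrable_mulR.
rewrite [X in EFin \o X](_ : _ = fun x => complex.Re c * complex.Im (f x)
      + complex.Im c * complex.Re (f x)); last first.
  by apply/funext => x; rewrite ImM.
by apply: integrable_addR; exact: integrable_mulR.
Qed.

Lemma cintegralZ (c : R[i]) f : cintegrable f ->
  cintegral mu (fun x => c * f x) = c * cintegral mu f.
Proof.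
move=> [fr fi]; apply: eq_complexP; rewrite ?ReM ?ImM /=.
  rewrite -!RintegralZl// -RintegralB//; last 2 first.
  - exact: integrable_mulR.
  - exact: integrable_mulR.
  by apply: eq_Rintegral => x _; exact: ReM.
rewrite -!RintegralZl// -RintegralD//; last 2 first.
- exact: integrable_mulR.
- exact: integrable_mulR.
by apply: eq_Rintegral => x _; exact: ImM.
Qed.

Lemma cintegralJ f : cintegrable f ->
  cintegral mu (fun x => (f x)^*) = (cintegral mu f)^*.
Proof.
move=> [fr fi]; apply: eq_complexP => /=.
  by apply: eq_Rintegral => x _; exact: ReJ.
rewrite -mulN1r -RintegralZl//.
by apply: eq_Rintegral => x _; rewrite mulN1r; exact: ImJ.
Qed.

(* [\int u <= \int u^+], and the integral of non-negative functions, a supremum over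
   simple functions, is monotone without any measurability. *)
Lemma Rintegral_le_ge0 (u : T -> R) (v : T -> \bar R) :
  (forall x, 0 <= v x)%E -> (forall x, (u x)%:E <= v x)%E ->
  (\int[mu]_x v x < +oo)%E ->
  ((\int[mu]_x u x)%:E <= \int[mu]_x v x)%E.
Proof.
move=> v0 uv voo.
have up0 x : (0 <= (EFin \o u)^\+ x)%E by exact: funepos_ge0.
have upv : (\int[mu]_x (EFin \o u)^\+ x <= \int[mu]_x v x)%E.
  rewrite !ge0_integralTE//; apply: ereal_sup_le => _ /= [h hu <-].
  exists h => // x.
  apply: le_trans (hu x) _; rewrite funeposE ge_max v0 andbT; exact: uv.
have un0 : (0 <= \int[mu]_x (EFin \o u)^\- x)%E by apply: integral_ge0 => x _; exact: funeneg_ge0.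
rewrite /Rintegral integralE.
have up0' : (0 <= \int[mu]_x (EFin \o u)^\+ x)%E by apply: integral_ge0.
have vp0 : (0 <= \int[mu]_x v x)%E by apply: integral_ge0.
move: (\int[mu]_x _)%E (\int[mu]_x _)%E (\int[mu]_x _)%E un0 up0' upv vp0 voo.
move=> [n| |]// [p| |]// [w| |]//=; rewrite ?lee_fin// => n0 p0 pw.
by move=> _ _; lra.
Qed.

End complex_integral.

(** * Square-integrable functions, Cauchy-Schwarz and Bessel *)

Section square_integrable.
Variable R : realType.
Local Notation mu := (leb R).
Implicit Types f g h : R -> R[i].

Lemma measurable_nsq d (T : measurableType d) (f : T -> R[i]) :
  cmeasurable f -> measurable_fun setT (fun x => nsq (f x)).
Proof. by move=> [mr mi]; apply: measurable_funD; exact: measurable_funX. Qed.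

Lemma L2normE f : L2norm f = ((\int[mu]_x (nsq (f x))%:E) `^ 2^-1)%E.
Proof.
rewrite /L2norm /cLnorm unlock; congr (_ `^ _)%E.
apply: eq_integral => x _ /=.
by rewrite normcE ger0_norm ?sqrtr_ge0// powR_mulrn ?sqrtr_ge0// sqr_sqrtr// nsq_ge0.
Qed.

Lemma L2P f : L2 f <->
  cmeasurable f /\ mu.-integrable setT (EFin \o (fun x => nsq (f x))).
Proof.
have I0 : (0 <= \int[mu]_x (nsq (f x))%:E)%E.
  by apply: integral_ge0 => x _; rewrite lee_fin nsq_ge0.
rewrite /L2 /cLp -/(L2norm f) L2normE.
split=> [[mf foo]|[mf fi]]; split=> //.
  have mn := measurable_nsq mf.
  apply/integrableP; split; first exact/measurable_EFinP.
  under eq_integral do rewrite gee0_abs ?lee_fin ?nsq_ge0//.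
  by apply: lty_poweRy foo; rewrite invr_eq0.
apply: poweR_lty.
by have := integrable_fin_num measurableT fi; rewrite ge0_fin_numE.
Qed.

(** The squared norm as a real number. An infinite integral is read as [0], hence the assumption
    [L2 f] in the comparison with [L2norm]. *)
Definition nsq2 f : R := \int[mu]_x nsq (f x).

Lemma nsq2_ge0 f : 0 <= nsq2 f.
Proof. by apply: Rintegral_ge0 => x _; exact: nsq_ge0. Qed.

Lemma L2norm_sqrt f : L2 f -> L2norm f = (Num.sqrt (nsq2 f))%:E.
Proof.
move=> /L2P[mf fi]; rewrite L2normE -powR12_sqrt ?nsq2_ge0// -poweR_EFin.
by rewrite /nsq2 /Rintegral fineK// integrable_fin_num.
Qed.

Lemma cmeasurableD d (T : measurableType d) (f g : T -> R[i]) :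
  cmeasurable f -> cmeasurable g -> cmeasurable (fun x => f x + g x).
Proof.
move=> [fr fi] [gr gi]; split.
  by under eq_fun do rewrite ReD; exact: measurable_funD.
by under eq_fun do rewrite ImD; exact: measurable_funD.
Qed.

Lemma cmeasurableM d (T : measurableType d) (f g : T -> R[i]) :
  cmeasurable f -> cmeasurable g -> cmeasurable (fun x => f x * g x).
Proof.
move=> [fr fi] [gr gi]; split.
  by under eq_fun do rewrite ReM; apply: measurable_funB; exact: measurable_funM.
by under eq_fun do rewrite ImM; apply: measurable_funD; exact: measurable_funM.
Qed.

Lemma cmeasurable_cst d (T : measurableType d) (c : R[i]) :
  cmeasurable (fun _ : T => c).
Proof. by split; exact: measurable_cst. Qed.

Lemma cmeasurableJ d (T : measurableType d) (f : T -> R[i]) :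
  cmeasurable f -> cmeasurable (fun x => (f x)^*).
Proof.
move=> [fr fi]; split; first by under eq_fun do rewrite ReJ.
by under eq_fun do rewrite ImJ; exact: measurableT_comp.
Qed.

Lemma L2_linear (c : R[i]) f g : L2 f -> L2 g -> L2 (fun x => f x + c * g x).
Proof.
move=> /L2P[mf fi] /L2P[mg gi]; apply/L2P.
have mh : cmeasurable (fun x => f x + c * g x).
  by apply: cmeasurableD => //; apply: cmeasurableM => //; exact: cmeasurable_cst.
split=> //.
(* The dominating function comes from |u + v|^2 <= 2 |u|^2 + 2 |v|^2. *)
have := integrable_addR (integrable_mulR 2 fi) (integrable_mulR (2 * nsq c) gi).
apply: le_integrable => //; first exact/measurable_EFinP/measurable_nsq.
move=> x _ /=; rewrite lee_fin !ger0_norm ?nsq_ge0//; last first.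
  by rewrite addr_ge0// !mulr_ge0// nsq_ge0.
rewrite -mulrA -nsqM /nsq ReD ImD.
set a := complex.Re (f x); set b := complex.Im (f x).
set a' := complex.Re _; set b' := complex.Im _.
by have := sqr_ge0 (a - a'); have := sqr_ge0 (b - b'); lra.
Qed.

Lemma inner_integrable f g : L2 f -> L2 g ->
  cintegrable mu (fun t => (f t)^* * g t).
Proof.
move=> /L2P[mf fi] /L2P[mg gi].
have [mr mi] := cmeasurableM (cmeasurableJ mf) mg.
(* The sum |f|^2 + |g|^2 dominates both the real and the imaginary part of the product. *)
have H := integrable_addR fi gi.
split; apply: le_integrable H => //; try exact/measurable_EFinP.
  move=> x _ /=; rewrite lee_fin [leRHS]ger0_norm; last by apply: addr_ge0; exact: nsq_ge0.
  rewrite ReM ReJ ImJ /nsq; set a := complex.Re (f x); set b := complex.Im (f x).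
  set a' := complex.Re _; set b' := complex.Im _; rewrite ler_norml.
  have := sqr_ge0 (a - a'); have := sqr_ge0 (b - b').
  have := sqr_ge0 (a + a'); have := sqr_ge0 (b + b').
  have := sqr_ge0 a; have := sqr_ge0 b; have := sqr_ge0 a'; have := sqr_ge0 b'.
  by lra.
move=> x _ /=; rewrite lee_fin [leRHS]ger0_norm; last by apply: addr_ge0; exact: nsq_ge0.
rewrite ImM ReJ ImJ /nsq; set a := complex.Re (f x); set b := complex.Im (f x).
set a' := complex.Re _; set b' := complex.Im _; rewrite ler_norml.
have := sqr_ge0 (a - b'); have := sqr_ge0 (b - a').
have := sqr_ge0 (a + b'); have := sqr_ge0 (b + a').
have := sqr_ge0 a; have := sqr_ge0 b; have := sqr_ge0 a'; have := sqr_ge0 b'.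
by lra.
Qed.

Lemma inner_linear (c : R[i]) f g h : L2 f -> L2 g -> L2 h ->
  inner f (fun t => g t + c * h t) = inner f g + c * inner f h.
Proof.
move=> f2 g2 h2; have ig := inner_integrable f2 g2; have ih := inner_integrable f2 h2.
rewrite /inner -cintegralZ// -cintegralD//; last exact: cintegrableZ.
by congr cintegral; apply/funext => t; ring.
Qed.

Lemma innerJ f g : L2 f -> L2 g -> inner g f = (inner f g)^*.
Proof.
move=> f2 g2; rewrite /inner -cintegralJ; last exact: inner_integrable.
by congr cintegral; apply/funext => t; rewrite rmorphM/= conjcK mulrC.
Qed.

Lemma innerxx f : inner f f = (nsq2 f)%:C.
Proof.
apply: eq_complexP => /=.
  by apply: eq_Rintegral => x _; rewrite conjM_nsq.
rewrite -(mulr0 (0 : R)); under eq_Rintegral do rewrite conjM_nsq /=.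
by rewrite mulr0 /Rintegral integral0.
Qed.


(* Expand [0 <= |f - (<h, f> / |h|^2) h|^2]. *)
Lemma cauchy_schwarz h f : L2 h -> L2 f -> 0 < nsq2 h ->
  nsq (inner h f) <= nsq2 h * nsq2 f.
Proof.
move=> h2 f2 N0; have NE := innerxx h; move: (nsq2 h) N0 NE => N N0 NE.
have [c cE] : exists c, c = inner h f by eexists.
pose x := fun t => f t + - (c * (N^-1)%:C) * h t.
have x2 : L2 x by exact: L2_linear.
have hx : inner h x = 0.
  rewrite inner_linear// NE -cE mulNr -mulrA -realcM mulVf ?gt_eqF//.
  by rewrite [_%:C]/(1 : R[i]) mulr1 subrr.
have fx : inner f x = (nsq2 f - nsq c / N)%:C.
  rewrite inner_linear// innerxx (innerJ h2 f2) -cE mulNr mulrAC [c * _]mulrC.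
  by rewrite conjM_nsq -realcM -realcB.
have xx : inner x x = (nsq2 f - nsq c / N)%:C.
  rewrite {2}/x inner_linear// (innerJ h2 x2) hx conjc0 mulr0 addr0.
  by rewrite (innerJ f2 x2) fx conjc_real.
have := nsq2_ge0 x; move: xx; rewrite innerxx => -[->].
by rewrite -cE subr_ge0 ler_pdivrMr// (mulrC N).
Qed.

(** As [h] is orthogonal to [e], it sees only the component [x] of [f] orthogonal to [e]. That
    component has squared norm 1 - |<e, f>|^2, and Cauchy-Schwarz applies to [h] and [x]. *)
Lemma bessel h e f : L2 h -> L2 e -> L2 f -> inner e h = 0 ->
  nsq2 e = 1 -> nsq2 f = 1 -> 0 < nsq2 h ->
  nsq (inner h f) <= nsq2 h * (1 - nsq (inner e f)).
Proof.
move=> h2 e2 f2 eh e1 f1 h0.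
have [k kE] : exists k, k = inner e f by eexists.
pose x := fun t => f t + - k * e t.
have x2 : L2 x by exact: L2_linear.
have hx : inner h x = inner h f.
  by rewrite inner_linear// (innerJ e2 h2) eh conjc0 mulr0 addr0.
have ex : inner e x = 0.
  by rewrite inner_linear// innerxx e1 -kE [_%:C]/(1 : R[i]) mulr1 addrN.
have fx : inner f x = (1 - nsq k)%:C.
  rewrite inner_linear// innerxx f1 (innerJ e2 f2) -kE mulNr [k * _]mulrC.
  by rewrite conjM_nsq -realcB.
have xx : inner x x = (1 - nsq k)%:C.
  rewrite {2}/x inner_linear// (innerJ e2 x2) ex conjc0 mulr0 addr0.
  by rewrite (innerJ f2 x2) fx conjc_real.
have := cauchy_schwarz h2 x2 h0; rewrite hx -kE.
by move: xx; rewrite innerxx => -[->].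
Qed.

End square_integrable.

(** * Time-frequency shifts of Gaussian chirps *)

Section time_frequency_shift.
Variable R : realType.
Local Notation mu := (leb R).

Definition cis (x : R) : R[i] := cos x +i* sin x.

Lemma cisD x y : cis (x + y) = cis x * cis y.
Proof. by apply: eq_complexP; rewrite /= ?cosD ?sinD; ring. Qed.

Lemma nsq_cis x : nsq (cis x) = 1.
Proof. exact: cos2Dsin2. Qed.

Lemma cmeasurable_cis d (T : measurableType d) (f : T -> R) :
  measurable_fun setT f -> cmeasurable (fun x => cis (f x)).
Proof.
by move=> mf; split; [exact: measurable_cos_comp | exact: measurable_sin_comp].
Qed.

Lemma cmeasurable_addr (c : R) (f : R -> R[i]) : cmeasurable f ->
  cmeasurable (fun t : R => f (t + c)).
Proof.
have mc : measurable_fun setT (fun t : R => t + c).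
  by apply: measurable_funD => //; exact: measurable_cst.
by move=> [fr fi]; split; [exact: measurableT_comp fr mc|exact: measurableT_comp fi mc].
Qed.

Lemma nsq_tfshift (nu : R * R) (f : R -> R[i]) t :
  nsq (tfshift nu f t) = nsq (f (1 * t + - nu.1)).
Proof. by rewrite /tfshift nsqM nsq_cis !mul1r. Qed.

Lemma L2_tfshift (nu : R * R) (f : R -> R[i]) : L2 f -> L2 (tfshift nu f).
Proof.
move=> /L2P[mf fi]; apply/L2P; split.
  apply: cmeasurableM; last exact: cmeasurable_addr.
  by apply: cmeasurable_cis; exact: measurable_funM.
have := integrable_affine (- nu.1) ltr01 fi.
by under [X in _ -> _.-integrable _ (EFin \o X)]eq_fun do rewrite nsq_tfshift.
Qed.

Lemma nsq2_tfshift (nu : R * R) (f : R -> R[i]) : L2 f ->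
  nsq2 (tfshift nu f) = nsq2 f.
Proof.
move=> /L2P[mf fi]; rewrite /nsq2 (Rintegral_affine (- nu.1) ltr01 fi) mul1r.
by apply: eq_Rintegral => t _; rewrite nsq_tfshift.
Qed.

(** The nested roots form the fourth root that gives unit norm. The quadratic phase shears the
    time-frequency plane and so supplies the cross term of the quadratic form. *)
Definition chirp (al be : R) (t : R) : R[i] :=
  (Num.sqrt (Num.sqrt (2 * al)) * expR (- (pi * al * t ^+ 2)))%:C
  * cis (- (pi * be * t ^+ 2)).

Section chirp.
Variables (al be : R).
Hypothesis al0 : 0 < al.
Let pal0 : 0 < 2 * pi * al.
Proof. by rewrite !mulr_gt0// pi_gt0. Qed.
Let piN0 : pi != 0 :> R.
Proof. by rewrite gt_eqF// pi_gt0. Qed.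
Let alN0 : al != 0.
Proof. by rewrite gt_eqF. Qed.

Lemma nsq_chirp t :
  nsq (chirp al be t) = Num.sqrt (2 * al) * expR (- (2 * pi * al * t ^+ 2)).
Proof.
rewrite /chirp nsqM nsq_cis mulr1 /nsq /= expr0n addr0 exprMn.
rewrite sqr_sqrtr ?sqrtr_ge0// -expRM_natl; congr (_ * expR _).
by rewrite mulrN !mulrA.
Qed.

Lemma L2_chirp : L2 (chirp al be).
Proof.
have msq (k : R) : measurable_fun setT (fun t : R => - (k * t ^+ 2)).
  by apply: measurableT_comp => //; apply: measurable_funM => //; exact: measurable_funX.
apply/L2P; split.
  apply: cmeasurableM; last exact: cmeasurable_cis.
  by split => //=; apply: measurable_funM => //; exact: measurableT_comp.
have := integrable_mulR (Num.sqrt (2 * al)) (integrable_gauss pal0).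
by under [X in _ -> _.-integrable _ (EFin \o X)]eq_fun do rewrite nsq_chirp.
Qed.

Lemma nsq2_chirp : nsq2 (chirp al be) = 1.
Proof.
rewrite /nsq2; under eq_Rintegral do rewrite nsq_chirp.
rewrite RintegralZl//; last exact: integrable_gauss.
rewrite Rintegral_gauss// -sqrtrM; last by rewrite mulr_ge0// ltW.
rewrite (_ : _ * _ = 1) ?sqrtr1//.
by move: (@pi R) piN0 => p p0; field; rewrite ?p0 ?alN0.
Qed.

Lemma tfshift2_chirp (c nu : R * R) t :
  tfshift nu (tfshift c (chirp al be)) t =
  (Num.sqrt (Num.sqrt (2 * al)) * expR (- (pi * al * (t - nu.1 - c.1) ^+ 2)))%:C *
  cis (2 * pi * nu.2 * t + 2 * pi * c.2 * (t - nu.1) - pi * be * (t - nu.1 - c.1) ^+ 2).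
Proof.
rewrite /tfshift /chirp -!/(cis _) 2!cisD; ring.
Qed.

Lemma Re_polar (a b x y z : R) :
  complex.Re (cis z * ((a%:C * cis x)^*%C * (b%:C * cis y))) =
  a * b * cos (z + (y - x)).
Proof.
have -> : (a%:C * cis x)^*%C = a%:C * cis (- x).
  by apply: eq_complexP; rewrite /= ?cosN ?sinN; ring.
have -> : cis z * (a%:C * cis (- x) * (b%:C * cis y)) = (a * b)%:C * cis (z + (y - x)).
  by rewrite realcM !cisD; ring.
by rewrite ReM /= mul0r subr0.
Qed.

(* With [delta = nu.1 - c.1] and [omega = nu.2 - c.2 + be * delta] the product of the
   two shifted chirps is, around the midpoint of their centres, a Gaussian of
   frequency [omega]. *)
Lemma chirp_overlap (c nu mu0 : R * R) :
  expR (- (pi * (al * (nu.1 - c.1) ^+ 2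
                 + (be * (nu.1 - c.1) + (nu.2 - c.2)) ^+ 2 / al)))
  <= nsq (inner (tfshift mu0 (tfshift c (chirp al be)))
                (tfshift nu (tfshift mu0 (chirp al be)))).
Proof.
set e := tfshift mu0 _; set f := tfshift nu _.
have e2 : L2 e by do 2 apply: L2_tfshift; exact: L2_chirp.
have f2 : L2 f by do 2 apply: L2_tfshift; exact: L2_chirp.
have ief := inner_integrable e2 f2.
set del := nu.1 - c.1; set om := be * del + _.
pose m := mu0.1 + (c.1 + nu.1) / 2.
(* [Phi] is the phase of [f] minus that of [e]. Both carry the same [be], so the terms in t^2 cancel
   and [Phi] is affine of slope 2 pi om; [mu0] survives only in the constant term, which the factor
   [cis (- Phi m)] removes. *)
pose Phi t := (2 * pi * nu.2 * t + 2 * pi * mu0.2 * (t - nu.1) - pi * be * (t - nu.1 - mu0.1) ^+ 2)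
  - (2 * pi * mu0.2 * t + 2 * pi * c.2 * (t - mu0.1) - pi * be * (t - mu0.1 - c.1) ^+ 2).
have [izr _] := cintegrableZ (cis (- Phi m)) ief.
have ReE : complex.Re (cis (- Phi m) * inner e f) = expR (- (pi / 2 * (al * del ^+ 2 + om ^+ 2 / al))).
  rewrite /inner -cintegralZ//= (Rintegral_affine m ltr01 izr) mul1r.
  (* Around the midpoint the two Gaussians are centred at del / 2 and - del / 2, and (u + del / 2)^2
     + (u - del / 2)^2 = 2 u^2 + del^2 / 2. *)
  transitivity (\int[mu]_u (Num.sqrt (2 * al) * expR (- (pi / 2 * al * del ^+ 2)) *
      (expR (- (2 * pi * al * u ^+ 2)) * cos (2 * pi * om * u)))).
    apply: eq_Rintegral => u _.
    rewrite /e /f !tfshift2_chirp Re_polar.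
    rewrite (_ : - Phi m + _ = 2 * pi * om * u); last by rewrite /Phi /om /del /m; field.
    rewrite mulrACA -expr2 sqr_sqrtr ?sqrtr_ge0// -expRD.
    rewrite [RHS]mulrA; congr (_ * cos _); rewrite -[RHS]mulrA -expRD.
    by congr (_ * expR _); rewrite /del /m; field.
  rewrite RintegralZl//; last first.
    apply: (integrable_gauss_bound (C := 1) pal0) => [|x].
      apply: measurable_funM; last by apply: measurable_cos_comp; exact: measurable_funM.
      apply: measurableT_comp => //; apply: measurableT_comp => //.
      by apply: measurable_funM => //; exact: measurable_funX.
    by rewrite normrM ger0_norm ?expR_ge0// mul1r ler_piMr ?expR_ge0// ler_norml cos_geN1 cos_le1.
  rewrite Rintegral_gauss_cos_scaled// mulrACA -sqrtrM; last by rewrite mulr_ge0// ltW.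
  rewrite (_ : 2 * al * _ = 1); last first.
    by move: (@pi R) piN0 => p p0; field; rewrite ?p0 ?alN0.
  rewrite sqrtr1 mul1r -expRD; congr expR.
  by move: (@pi R) piN0 => p p0; field; rewrite ?p0 ?alN0.
have <- : nsq (cis (- Phi m) * inner e f) = nsq (inner e f) by rewrite nsqM nsq_cis mul1r.
(* The squared modulus is at least the square of the real part. *)
rewrite /nsq ReE -expRM_natl ler_wpDr ?sqr_ge0// ler_expR.
by move: (_ + _ / al) (@pi R) => Q p; lra.
Qed.

End chirp.
End time_frequency_shift.

(** * Hoelder's inequality *)

Section hoelder_extended.
Context d (T : measurableType d) (R : realType) (mu : {measure set T -> \bar R}).
Local Open Scope ereal_scope.

Lemma ge0_hoelder (f g : T -> R) (a : \bar R) (b : R) : 1 < a -> a^-1 + (b^-1)%:E = 1 ->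
  0 < mu setT ->
  measurable_fun setT f -> measurable_fun setT g ->
  (forall x, 0 <= f x)%R -> (forall x, 0 <= g x)%R ->
  \int[mu]_x (f x * g x)%:E <= 'N[mu]_a[EFin \o f] * 'N[mu]_b%:E[EFin \o g].
Proof.
move=> a1 ab muT mf mg f0 g0.
have fg1 : \int[mu]_x (f x * g x)%:E = 'N[mu]_1[EFin \o (f \* g)%R].
  by rewrite Lnorm1; apply: eq_integral => x _; rewrite /= ger0_norm ?mulr_ge0.
case: a a1 ab => [a||]//; rewrite ?lte_fin => a1.
  have a0 : (0 < a)%R by rewrite (lt_trans _ a1).
  rewrite inver gt_eqF// -EFinD => -[ab].
  have bV0 : (0 < b^-1)%R by rewrite -(ltrD2l a^-1) ab addr0 invf_lt1.
  by rewrite fg1; apply: hoelder => //; rewrite -invr_gt0.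
rewrite invey add0e => -[b1].
have {b1} -> : b = 1%R by rewrite -(invrK b) b1 invr1.
(* The L^oo norm unfolds to the essential supremum because the total mass is positive. *)
have -> : 'N[mu]_+oo[EFin \o f] = ess_sup mu (abse \o (EFin \o f)) by rewrite unlock muT.
rewrite Lnorm1.
set S := ess_sup _ _.
have S0 : 0 <= S by apply: ess_sup_gee => //; apply: nearW => x /=.
have -> : \int[mu]_x `|(EFin \o g) x| = \int[mu]_x (g x)%:E.
  by apply: eq_integral => x _; rewrite /= ger0_norm.
have mgE : measurable_fun setT (EFin \o g) by exact/measurable_EFinP.
(* When [S] is infinite, either the integral of [g] is positive and the right-hand side is +oo, or
   [g] vanishes almost everywhere and both sides are 0. *)
have [Soo|Sfin] := eqVneq S +oo.
  have [g00|gn0] := eqVneq (\int[mu]_x (g x)%:E) 0; last first.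
    rewrite Soo gt0_mulye ?leey// lt0e gn0 integral_ge0// => x _.
    by rewrite lee_fin.
  rewrite g00 mule0.
  have : ae_eq mu setT (EFin \o g) (cst 0).
    apply/(ae_eq_integral_abs mu measurableT mgE).
    by rewrite -[RHS]g00; apply: eq_integral => x _; rewrite /= ger0_norm.
  move=> g_ae.
  rewrite (ge0_ae_eq_integral (g := cst 0))//.
  - by rewrite integral_cst// mul0e.
  - by apply/measurable_EFinP; exact: measurable_funM.
  - by move=> x _; rewrite lee_fin mulr_ge0.
  - by apply: filterS g_ae => x /= + _ => /(_ I) [->]; rewrite mulr0.
have Sr : S = (fine S)%:E by rewrite fineK// ge0_fin_numE// ltey.
rewrite Sr -ge0_integralZl//; last 2 first.
- by move=> x _; rewrite lee_fin.
- by rewrite -Sr.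
apply: ae_ge0_le_integral => //.
- by move=> x _; rewrite lee_fin mulr_ge0.
- by apply/measurable_EFinP; exact: measurable_funM.
- by move=> x _; rewrite mule_ge0// ?lee_fin// -lee_fin -Sr.
- by apply: measurable_funeM.
- apply: filterS (ess_sup_ge mu (abse \o (EFin \o f))) => x /= fS _.
  rewrite EFinM lee_pmul ?lee_fin//.
  by rewrite -lee_fin -Sr; apply: le_trans fS; rewrite lee_fin ler_norm.
Qed.

(* On a set of measure at most [1] the L^b-norm increases with [b], whereas
   [w ^ b <= w ^ 2] pointwise for [b >= 2]. *)
Lemma Lnorm_le_max2 (U : set T) (w : T -> R) (b : R) : (1 <= b)%R ->
  measurable U -> mu U <= 1 -> measurable_fun setT w ->
  (forall x, 0 <= w x <= 1)%R -> (forall x, ~ U x -> w x = 0%R) ->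
  'N[mu]_b%:E[EFin \o w] <= (\int[mu]_x (w x ^+ 2)%:E) `^ ((Num.max b 2)^-1)%R.
Proof.
move=> b1 mU U1 mw w01 wU.
have w0 x : (0 <= w x)%R by have /andP[] := w01 x.
have b0 : (0 < b)%R by exact: lt_le_trans b1.
have mwb (r : R) : measurable_fun setT (fun x => w x `^ r)%R.
  exact: measurableT_comp (measurable_powR r) mw.
rewrite unlock.
have -> : \int[mu]_x `|(EFin \o w) x| `^ b = \int[mu]_x (w x `^ b)%:E.
  by apply: eq_integral => x _; rewrite /= ger0_norm.
have I0 (r : R) : 0 <= \int[mu]_x (w x `^ r)%:E.
  by apply: integral_ge0 => x _; rewrite lee_fin powR_ge0.
have w2E : \int[mu]_x (w x ^+ 2)%:E = \int[mu]_x (w x `^ 2)%:E.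
  by apply: eq_integral => x _; rewrite powR_mulrn.
rewrite w2E; case: (leP 2%R b) => b2.
  apply: gt0_ler_poweR; rewrite ?in_itv/= ?leey ?andbT//.
    by rewrite invr_ge0 ltW.
  apply: ge0_le_integral => //.
  - by move=> x _; rewrite lee_fin powR_ge0.
  - exact/measurable_EFinP.
  - exact/measurable_EFinP.
  - move=> x _; rewrite lee_fin; have /andP[_ w1] := w01 x.
    have [->|wn0] := eqVneq (w x) 0%R; first by rewrite !powR0// gt_eqF.
    by rewrite ger_powR// lt_neqAle eq_sym wn0 w0.
(* For [b < 2], Hoelder with the conjugate exponents 2 / b and 2 / (2 - b) is applied to w^b and the
   indicator of [U], whose norm is at most 1. *)
have p0 : (0 < 2 / b)%R by rewrite divr_gt0.
have q0 : (0 < 2 / (2 - b))%R by rewrite divr_gt0// subr_gt0.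
have pq : ((2 / b)^-1 + (2 / (2 - b))^-1 = 1)%R by rewrite !invf_div; field.
have := hoelder mu (mwb b) (measurable_indic mU : measurable_fun setT (\1_U : T -> R)) p0 q0 pq.
have -> : 'N[mu]_1[EFin \o ((fun x => w x `^ b)%R \* \1_U)%R] = \int[mu]_x (w x `^ b)%:E.
  rewrite Lnorm1; apply: eq_integral => x _ /=.
  rewrite ger0_norm ?mulr_ge0 ?powR_ge0//.
  have [xU|xU] := pselect (U x); first by rewrite indicE mem_set// mulr1.
  by rewrite wU// powR0 ?gt_eqF// mul0r.
have -> : 'N[mu]_(2 / b)%:E[EFin \o (fun x => w x `^ b)%R] = (\int[mu]_x (w x `^ 2)%:E) `^ (b / 2).
  rewrite unlock invf_div; congr (_ `^ _); apply: eq_integral => x _ /=.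
  by rewrite ger0_norm ?powR_ge0// -powRrM mulrC mulfVK ?gt_eqF.
have NU : 'N[mu]_(2 / (2 - b))%:E[EFin \o (\1_U : T -> R)] <= 1.
  rewrite unlock (_ : \int[mu]_x _ = mu U); last first.
    rewrite -[in RHS](setIT U) -integral_indic//; apply: eq_integral => x _ /=.
    by rewrite ger0_norm// indicE; case: (x \in U); rewrite ?powR1// powR0// gt_eqF.
  rewrite -[leRHS](poweR1r (2 / (2 - b))^-1); apply: gt0_ler_poweR => //;
    rewrite ?in_itv/= ?leey ?andbT//.
  by rewrite invr_ge0 ltW.
move=> H.
have {H NU}H : \int[mu]_x (w x `^ b)%:E <= (\int[mu]_x (w x `^ 2)%:E) `^ (b / 2).
  by apply: le_trans H _; rewrite -[leRHS]mule1 lee_wpmul2l// poweR_ge0.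
have -> : (2^-1 = b / 2 * b^-1)%R by rewrite mulrAC mulfV ?gt_eqF// mul1r.
rewrite poweRrM; apply: gt0_ler_poweR; rewrite ?in_itv/= ?leey ?andbT//.
- by rewrite invr_ge0 ltW.
- exact: poweR_ge0.
Qed.

End hoelder_extended.

(** * The Gaussian mass of a square *)

Section gaussian_square.
Variable R : realType.
Local Notation plane := (measurableTypeR R * measurableTypeR R)%type.

Let g (x : R) := expR (- (pi * x ^+ 2)).

Let g_integrable (i : interval R) : (leb R).-integrable [set` i] (EFin \o g).
Proof.
by apply: (integrableS measurableT) => //; exact: integrable_gauss (pi_gt0 R).
Qed.

Let measurable_g : measurable_fun setT g.
Proof.
apply: measurableT_comp => //; apply: measurableT_comp => //.
by apply: measurable_funM => //; exact: measurable_funX.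
Qed.

Let Rintegral_g_sym (a : R) : 0 <= a ->
  \int[leb R]_(x in `[- a, a]) g x = 2 * \int[leb R]_(x in `[0, a]) g x.
Proof.
move=> a0.
have Hs : \int[leb R]_(x in `[- a, 0]) g x = \int[leb R]_(x in `[0, a]) g x.
  rewrite /Rintegral; congr fine.
  have cg : {within `[- a, - 0], continuous g}.
    apply: continuous_subspaceT => x.
    apply: (@continuous_comp _ _ _ (fun x : R => - (pi * x ^+ 2)) expR); last exact: continuous_expR.
    apply: continuousN; apply: continuousM; first exact: cst_continuous.
    exact: exprn_continuous.
  have := integration_by_substitution_oppr a0 cg; rewrite oppr0 => ->.
  by apply: eq_integral => x _; rewrite /g /= sqrrN.
have := @Rintegral_itvB R g (BLeft (- a)) (BRight a) 0 (g_integrable _).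
rewrite !bnd_simp oppr_le0 a0 => /(_ isT isT).
rewrite Rintegral_itv_obnd_cbnd// Hs => H.
by move/eqP : H; rewrite subr_eq => /eqP ->; ring.
Qed.

(** The substitution t = sqrt pi * x cancels the root in the normalisation of [erf]; the remaining
    factor 2 is the symmetry of the Gaussian. *)
Lemma erf_Rintegral (a : R) : 0 < a ->
  erf (Num.sqrt pi * a) = \int[leb R]_(x in `[- a, a]) expR (- (pi * x ^+ 2)).
Proof.
move=> a0; have sp0 : 0 < Num.sqrt (@pi R) by rewrite sqrtr_gt0 pi_gt0.
rewrite (Rintegral_g_sym (ltW a0)) /erf.
rewrite [X in _ - X](_ : _ = 0) ?subr0; last first.
  by rewrite set_itv_ge ?Rintegral_set0// bnd_simp -ltNge mulr_gt0.
have -> : \int[leb R]_(t in `[0, Num.sqrt pi * a]) expR (- t ^+ 2) =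
    Num.sqrt pi * \int[leb R]_(x in `[0, a]) g x.
  rewrite [LHS]Rintegral_mkcond [in RHS]Rintegral_mkcond.
  rewrite (Rintegral_affine 0 sp0); last first.
    rewrite -restrict_EFin; apply: (iffLR (integrable_mkcond _ _)) => //.
    exact: integrableS (@integrableT_gauss R).
  congr (_ * _); apply: eq_Rintegral => x _.
  rewrite !patchE addr0 !mem_setE !in_itv/= pmulr_rge0// ler_pM2l//.
  by case: ifP => // _; rewrite exprMn sqr_sqrtr ?pi_ge0.
by rewrite mulrA mulfVK ?gt_eqF.
Qed.

Definition centered_square (s : R) : set plane := `[- (s / 2), s / 2] `*` `[- (s / 2), s / 2].

Lemma measurable_centered_square s : measurable (centered_square s).
Proof. exact: measurableX. Qed.

Lemma leb2_centered_square s : 0 < s -> leb2 R (centered_square s) = (s ^+ 2)%:E.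
Proof.
move=> s0; set I := `[- (s / 2), s / 2]%classic : set R.
transitivity (lebesgue_measure I * lebesgue_measure I)%E.
  by apply: product_measure1E; exact: measurable_itv.
rewrite !lebesgue_measure_itv/= lte_fin gtrN ?divr_gt0//.
by rewrite -!EFinB -EFinM; congr EFin; field.
Qed.

Let gauss2 (z : plane) := expR (- (pi * (z.1 ^+ 2 + z.2 ^+ 2))).

Lemma measurable_gauss2 : measurable_fun setT gauss2.
Proof.
apply: measurableT_comp => //; apply: measurableT_comp => //.
apply: measurable_funM => //; apply: measurable_funD; apply: measurable_funX.
  exact: measurable_fst.
exact: measurable_snd.
Qed.

Lemma integral_gauss2_centered_square s : 0 < s ->
  (\int[leb2 R]_(z in centered_square s) (gauss2 z)%:E =
   (erf (Num.sqrt (pi * s ^+ 2 / 4)) ^+ 2)%:E)%E.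
Proof.
move=> s0; have s20 : 0 < s / 2 by rewrite divr_gt0.
have -> : Num.sqrt (pi * s ^+ 2 / 4) = Num.sqrt pi * (s / 2).
  rewrite -mulrA sqrtrM ?pi_ge0// (_ : s ^+ 2 / 4 = (s / 2) ^+ 2); last by field.
  by rewrite sqrtr_sqr ger0_norm// ltW.
rewrite erf_Rintegral//.
set I := `[- (s / 2), s / 2]%classic.
(* Extension by zero turns the integrand on the square into a product on the whole plane, to which
   Tonelli's theorem applies. *)
pose k := g \_ I.
have k0 x : 0 <= k x by rewrite /k patchE; case: ifP => // _; exact: expR_ge0.
have mk : measurable_fun setT k.
  have mI : measurable I by exact: measurable_itv.
  apply: (iffLR (measurable_restrictT g mI)).
  exact: measurable_funTS.
have kE : (\int[leb R]_x (k x)%:E = (\int[leb R]_(x in I) g x)%:E)%E.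
  have iI : (leb R).-integrable I (EFin \o g) := g_integrable _.
  have mI : measurable (I : set (measurableTypeR R)) by exact: measurable_itv.
  transitivity (\int[leb R]_(x in I) (EFin \o g) x)%E; last exact/esym/fineK/(integrable_fin_num mI iI).
  by rewrite [RHS]integral_mkcond; apply: eq_integral => x _; rewrite restrict_EFin.
pose K (z : plane) := (k z.1 * k z.2)%:E.
have mK : measurable_fun setT K.
  apply/measurable_EFinP; apply: measurable_funM.
    exact: measurableT_comp mk measurable_fst.
  exact: measurableT_comp mk measurable_snd.
have K0 z : (0 <= K z)%E by rewrite lee_fin mulr_ge0.
transitivity (\int[leb2 R]_z K z)%E.
  rewrite integral_mkcond; apply: eq_integral => -[x y] _.
  rewrite patchE /K /k !patchE /centered_square in_setX /=.
  case: (x \in I) => /=; case: (y \in I); rewrite ?mulr0 ?mul0r//.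
  by rewrite /gauss2 /g /= -expRD mulrDr opprD.
have mkE : measurable_fun (setT : set (measurableTypeR R)) (EFin \o k) by exact/measurable_EFinP.
have k0E (x : measurableTypeR R) : setT x -> (0 <= (EFin \o k) x)%E by move=> _; rewrite lee_fin.
have kZ (c : R) : 0 <= c ->
    (\int[leb R]_x (c * k x)%:E = (c * \int[leb R]_(x in I) g x)%:E)%E.
  move=> c0; have cE : (0 <= c%:E)%E by rewrite lee_fin.
  under eq_integral do rewrite EFinM.
  by have := ge0_integralZl (leb R) measurableT mkE k0E cE; rewrite /= => ->; rewrite kE.
transitivity (\int[leb R]_x \int[leb R]_y K (x, y))%E.
  exact: fubini_tonelli1.
transitivity (\int[leb R]_x ((\int[leb R]_(x in I) g x) * k x)%:E)%E.
  by apply: eq_integral => x _; rewrite /K/= kZ// mulrC.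
by rewrite kZ// Rintegral_ge0// => x _; exact: expR_ge0.
Qed.

Lemma integral_centered_square_defect s : 0 < s ->
  (\int[leb2 R]_(z in centered_square s) (1 - gauss2 z)%:E =
   (s ^+ 2 - erf (Num.sqrt (pi * s ^+ 2 / 4)) ^+ 2)%:E)%E.
Proof.
move=> s0; have mS := measurable_centered_square s.
have mg2 : measurable_fun (centered_square s) gauss2.
  by apply: measurable_funTS; exact: measurable_gauss2.
have g1 z : gauss2 z <= 1.
  by rewrite -expR0 ler_expR oppr_le0 mulr_ge0 ?pi_ge0// addr_ge0 ?sqr_ge0.
(* Both summands are non-negative and the total is finite, so the defect is obtained by
   subtraction. *)
have : (\int[leb2 R]_(z in centered_square s) ((1 - gauss2 z)%:E + (gauss2 z)%:E) = (s ^+ 2)%:E)%E.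
  rewrite -leb2_centered_square// -[RHS]mul1e -integral_cst//.
  by apply: eq_integral => z _; rewrite -EFinD subrK.
rewrite ge0_integralD//; last 4 first.
- by move=> z _; rewrite lee_fin subr_ge0.
- by apply/measurable_EFinP; exact: measurable_funB.
- by move=> z _; rewrite lee_fin expR_ge0.
- exact/measurable_EFinP.
rewrite integral_gauss2_centered_square//.
by case: (\int[_]_(z in _) _)%E => [r| |]//= -[H]; congr EFin; exact: canRL (addrK _) H.
Qed.

End gaussian_square.

(** * The residual of a channel operator *)

Section channel.
Variable R : realType.
Local Notation plane := (measurableTypeR R * measurableTypeR R)%type.

(** This is M^-1 (nu - c) when [\det M = 1], the inverse being written as the adjugate. *)
Definition canonical_coord (M : 'M[R]_2) (c nu : R * R) : R * R :=
  (M 1 1 * (nu.1 - c.1) - M 0 1 * (nu.2 - c.2),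
   - M 1 0 * (nu.1 - c.1) + M 0 0 * (nu.2 - c.2)).

Lemma det2 (M : 'M[R]_2) : \det M = M 0 0 * M 1 1 - M 0 1 * M 1 0.
Proof.
rewrite (expand_det_row M 0) !big_ord_recl big_ord0 addr0 /cofactor !det_mx11 !mxE.
have l0 : lift 0 0 = 1 :> 'I_2 by apply: val_inj.
have l1 : lift 1 0 = 0 :> 'I_2 by apply: val_inj.
by rewrite !l0 !l1 /= expr0 expr1 mul1r mulN1r mulrN.
Qed.

Lemma measure_preserving2_canonical_coord (M : 'M[R]_2) (c : R * R) : \det M = 1 ->
  measure_preserving2 (canonical_coord M c).
Proof.
rewrite det2 => M1.
have H : M 1 1 * M 0 0 - (- M 0 1) * (- M 1 0) = 1 by rewrite -M1; ring.
have := measure_preserving2_comp (measure_preserving2_linear H)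
  (measure_preserving2_translation c).
congr measure_preserving2; apply/funext => -[x y].
by rewrite /canonical_coord /= mulNr.
Qed.

(** As a preimage under a measure-preserving map, U is measurable, has area s^2 and admits the
    change of variables to the square. *)
Lemma canonical_square_preimage (M : 'M[R]_2) (c : R * R) (s : R) : \det M = 1 ->
  [set linear_act M x + c | x in `[- (s / 2), s / 2] `*` `[- (s / 2), s / 2]] =
  canonical_coord M c @^-1` centered_square s.
Proof.
rewrite det2 => M1; apply/seteqP; split=> [_ [[x y] xy <-]|[x y]] /=.
  suff -> : canonical_coord M c (linear_act M (x, y) + c) = (x, y) by [].
  rewrite /canonical_coord /linear_act /=; congr pair.
    by rewrite -[RHS]mul1r -M1; ring.
  by rewrite -[RHS]mul1r -M1; ring.
move=> H; exists (canonical_coord M c (x, y)) => //.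
rewrite /canonical_coord /linear_act -[RHS]/(x, y) /=.
have -> : (x, y) = (1 * (x - c.1) + c.1, 1 * (y - c.2) + c.2) by rewrite !mul1r !subrK.
by rewrite -M1; congr pair; rewrite /=; ring.
Qed.

(* [1 / al] and [be / al] are the coefficients of [y ^ 2] and [2 x y] in [|M^-1 (x, y)|^2];
   the coefficient of [x ^ 2] then agrees because [\det M = 1]. *)
Lemma chirp_form_canonical (M : 'M[R]_2) (c nu : R * R) : \det M = 1 ->
  let al := (M 0 0 ^+ 2 + M 0 1 ^+ 2)^-1 in
  let be := - al * (M 0 0 * M 1 0 + M 0 1 * M 1 1) in
  0 < al /\
  al * (nu.1 - c.1) ^+ 2 + (be * (nu.1 - c.1) + (nu.2 - c.2)) ^+ 2 / al =
  (canonical_coord M c nu).1 ^+ 2 + (canonical_coord M c nu).2 ^+ 2.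
Proof.
rewrite det2 => M1 al be.
have q0 : 0 < M 0 0 ^+ 2 + M 0 1 ^+ 2.
  rewrite lt_neqAle addr_ge0 ?sqr_ge0// andbT eq_sym paddr_eq0 ?sqr_ge0// !sqrf_eq0.
  apply/negP => /andP[/eqP p0 /eqP r0]; move/eqP: M1.
  by rewrite p0 r0 !mul0r subrr eq_sym oner_eq0.
split; first by rewrite /al invr_gt0.
rewrite /canonical_coord /be /al /=.
set de := nu.1 - c.1; set ep := nu.2 - c.2.
move: M1 q0 => {al be}; move: (M 0 0) (M 0 1) (M 1 0) (M 1 1) de ep => p q r t de ep M1 q0.
rewrite invrK.
have q0' : p ^+ 2 + q ^+ 2 != 0 by rewrite gt_eqF.
apply: (mulfI q0').
rewrite [LHS](_ : _ = (1 + (p * r + q * t) ^+ 2) * de ^+ 2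
  - 2 * (p * r + q * t) * (p ^+ 2 + q ^+ 2) * de * ep + (p ^+ 2 + q ^+ 2) ^+ 2 * ep ^+ 2).
  (* Lagrange's identity: (p t - q r)^2 + (p r + q t)^2 = (p^2 + q^2) (r^2 + t^2). *)
  rewrite [X in X + _ ^+ 2](_ : 1 = (p * t - q * r) ^+ 2); last by rewrite M1 expr1n.
  by ring.
by field.
Qed.

Variables (Sigma : R * R -> R[i]) (H : (R -> R[i]) -> (R -> R[i])) (W : plane -> R).
Hypothesis channel : channel_operator Sigma H.

(* [W nu] bounds the squared distance of [S_nu psi] to the line of [e]. *)
Lemma channel_residual_bound (e psi : R -> R[i]) :
  L2 e -> L2 psi -> nsq2 e = 1 -> nsq2 psi = 1 ->
  (forall nu, 1 - nsq (inner e (tfshift nu psi)) <= W nu) ->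
  measurable_fun setT (fun nu : plane => ComplexField.Normc.normc (Sigma nu) * Num.sqrt (W nu)) ->
  (\int[leb2 R]_nu (ComplexField.Normc.normc (Sigma nu) * Num.sqrt (W nu))%:E < +oo)%E ->
  (L2norm (fun t => H psi t - inner e (H psi) * e t)%R
   <= \int[leb2 R]_nu (ComplexField.Normc.normc (Sigma nu) * Num.sqrt (W nu))%:E)%E.
Proof.
move: channel => [HL2 HE] e2 psi2 e1 psi1 eW /measurable_EFinP mF.
set X := (\int[leb2 R]_nu _)%E => Xoo.
have X0 : (0 <= X)%E.
  by apply: integral_ge0 => nu _; rewrite lee_fin mulr_ge0 ?normcE ?sqrtr_ge0.
have Hp2 := HL2 _ psi2.
have [l lE] : exists l, l = inner e (H psi) by eexists.
rewrite -lE; pose h t := H psi t + - l * e t.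
rewrite (_ : (fun t => _) = h); last by apply/funext => t; rewrite /h mulNr.
have h2 : L2 h by exact: L2_linear.
rewrite L2norm_sqrt//.
have eh : inner e h = 0.
  by rewrite inner_linear// innerxx e1 -lE [_%:C]/(1 : R[i]) mulr1 addrN.
have hh : (nsq2 h)%:C = inner h (H psi).
  by rewrite -innerxx {2}/h inner_linear// (innerJ e2 h2) eh conjc0 mulr0 addr0.
have [->|N0] := eqVneq (nsq2 h) 0; first by rewrite sqrtr0.
have {}N0 : 0 < nsq2 h by rewrite lt_neqAle eq_sym N0 nsq2_ge0.
have [q qE] : exists q, q = Num.sqrt (nsq2 h) by eexists.
have q0 : 0 < q by rewrite qE sqrtr_gt0.
have q2 : nsq2 h = q * q by rewrite -expr2 qE sqr_sqrtr// nsq2_ge0.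
have qE0 : (0 <= q%:E)%E by rewrite lee_fin ltW.
have F0 (nu : plane) : setT nu ->
    (0 <= (ComplexField.Normc.normc (Sigma nu) * Num.sqrt (W nu))%:E)%E.
  by move=> _; rewrite lee_fin mulr_ge0 ?normcE ?sqrtr_ge0.
have XE : (q%:E * X = \int[leb2 R]_nu
    (q%:E * (ComplexField.Normc.normc (Sigma nu) * Num.sqrt (W nu))%:E))%E.
  exact: esym (ge0_integralZl (leb2 R) measurableT mF F0 qE0).
have q0E : (0 < q%:E)%E by rewrite lte_fin.
(* With q = |h| > 0, the goal q <= X becomes q^2 <= q X. Its left-hand side is <h, H psi>, which the
   weak definition of [H] tested against [h] itself turns into an integral; the factor q on the
   right comes from Bessel. *)
rewrite -qE -(lee_pmul2l (erefl : q%:E \is a fin_num) q0E).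
rewrite -EFinM -q2 (_ : nsq2 h =
  \int[leb2 R]_nu complex.Re (Sigma nu * cross_ambiguity h psi nu)); last first.
  by move: hh; rewrite HE// => -[].
rewrite XE; apply: Rintegral_le_ge0 => [nu|nu|].
- by rewrite mule_ge0// F0.
- rewrite -EFinM lee_fin (le_trans (Re_le_sqrt_nsq _))// nsqM sqrtrM ?nsq_ge0//.
  rewrite normcE mulrCA ler_wpM2l ?sqrtr_ge0// qE -sqrtrM ?nsq2_ge0// ler_wsqrtr//.
  have s2 := L2_tfshift nu psi2.
  rewrite (le_trans (bessel h2 e2 s2 eh e1 _ N0))// ?nsq2_tfshift//.
  by rewrite ler_wpM2l ?nsq2_ge0.
- by rewrite -XE lte_mul_pinfty.
Qed.

End channel.

(** * Choice of the pair and the final estimate *)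

Theorem mainTheorem2 (R : realType) (U : set (R * R)) (a : \bar R) (b : R)
    (U_gt0 : (0 < leb2 R U)%E) (U_le1 : (leb2 R U <= 1)%E)
    (U_square : canonically_equivalent_to_square U)
    (a_gt1 : (1 < a)%E) (ab : (a^-1 + (b^-1)%:E = 1)%E) :
  exists g gamma : R -> R[i],
    [/\ L2 g /\ L2 gamma, L2norm g = 1%E, L2norm gamma = 1%E &
      forall (Sigma : R * R -> R[i]) (H : (R -> R[i]) -> (R -> R[i])),
        cLp (leb2 R) a Sigma ->
        supported_in Sigma U ->
        channel_operator Sigma H ->
        forall mu : R * R,
          let lambda := inner (tfshift mu g) (H (tfshift mu gamma)) in
          (L2norm (fun t => H (tfshift mu gamma) t - lambda * tfshift mu g t)%R
           <= cLnorm (leb2 R) a Sigma *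
              ((fine (leb2 R U)
                - erf (Num.sqrt (pi * fine (leb2 R U) / 4)) ^+ 2)
               `^ (Num.max b 2)^-1)%R%:E)%E].
Proof.
case: U_square => s [M [c [s0 M1 UE]]].
pose phi := canonical_coord M c.
have mp : measure_preserving2 phi by exact: measure_preserving2_canonical_coord.
have mphi := mp.1.
have {}UE : U = phi @^-1` centered_square s by rewrite UE canonical_square_preimage.
have mU : measurable (U : set (measurableTypeR R * measurableTypeR R)).
  rewrite UE -[X in measurable X]setTI.
  by apply: mphi => //; exact: measurable_centered_square.
have sU : leb2 R U = (s ^+ 2)%:E.
  by rewrite UE mp.2 ?leb2_centered_square//; exact: measurable_centered_square.
rewrite sU /=.
pose al := (M 0 0 ^+ 2 + M 0 1 ^+ 2)^-1.
pose be := - al * (M 0 0 * M 1 0 + M 0 1 * M 1 1).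
have al0 : 0 < al by have [] := chirp_form_canonical c (0, 0) M1.
have formE nu : al * (nu.1 - c.1) ^+ 2 + (be * (nu.1 - c.1) + (nu.2 - c.2)) ^+ 2 / al =
    (phi nu).1 ^+ 2 + (phi nu).2 ^+ 2 by have [_] := chirp_form_canonical c nu M1.
pose gamma := chirp al be.
have gamma2 : L2 gamma by exact: L2_chirp.
have g2 : L2 (tfshift c gamma) by exact: L2_tfshift.
have gamma1 : nsq2 gamma = 1 by exact: nsq2_chirp.
have g1 : nsq2 (tfshift c gamma) = 1 by rewrite nsq2_tfshift.
exists (tfshift c gamma), gamma; split; [by []| | |].
- by rewrite L2norm_sqrt// g1 sqrtr1.
- by rewrite L2norm_sqrt// gamma1 sqrtr1.
move=> Sigma H [mS Sfin] suppS chan mu.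
pose D (z : measurableTypeR R * measurableTypeR R) : R :=
  1 - expR (- (pi * (z.1 ^+ 2 + z.2 ^+ 2))).
have mD : measurable_fun setT D by apply: measurable_funB => //; exact: measurable_gauss2.
have D0 z : 0 <= D z.
  by rewrite subr_ge0 -expR0 ler_expR oppr_le0 mulr_ge0 ?pi_ge0// addr_ge0 ?sqr_ge0.
have D1 z : D z <= 1 by rewrite lerBlDr lerDl expR_ge0.
pose W := D \o phi : measurableTypeR R * measurableTypeR R -> R.
have mW : measurable_fun setT W := measurableT_comp mD mphi.
have msqrt : measurable_fun setT (@Num.sqrt R).
  by apply: continuous_measurable_fun; exact: sqrt_continuous.
have mF : measurable_fun setT (fun nu : measurableTypeR R * measurableTypeR R =>
    ComplexField.Normc.normc (Sigma nu)).
  under eq_fun do rewrite normcE.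
  exact: measurableT_comp msqrt (measurable_nsq mS).
have msW : measurable_fun setT (fun nu => Num.sqrt (W nu)).
  exact: measurableT_comp msqrt mW.
have F0 nu : 0 <= ComplexField.Normc.normc (Sigma nu) by rewrite normcE sqrtr_ge0.
(* The cut-off to U leaves the integral against |Sigma| unchanged, since [Sigma] vanishes almost
   everywhere outside U, and makes the L^b norm of the weight one over a set of measure at most
   1. *)
pose w (nu : measurableTypeR R * measurableTypeR R) : R := Num.sqrt (W nu) * \1_U nu.
have mw : measurable_fun setT w by apply: measurable_funM => //; exact: measurable_indic.
have w0 nu : 0 <= w nu by rewrite mulr_ge0// sqrtr_ge0.
have w01 nu : 0 <= w nu <= 1.
  rewrite w0 /= mulr_ile1 ?sqrtr_ge0//.
  by rewrite -[leRHS]sqrtr1 ler_wsqrtr//; exact: D1.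
have FwE : (\int[leb2 R]_nu (ComplexField.Normc.normc (Sigma nu) * Num.sqrt (W nu))%:E =
    \int[leb2 R]_nu (ComplexField.Normc.normc (Sigma nu) * w nu)%:E)%E.
  apply: ge0_ae_eq_integral => //.
  - by apply/measurable_EFinP; exact: measurable_funM.
  - by apply/measurable_EFinP; exact: measurable_funM.
  - by move=> nu _; rewrite lee_fin mulr_ge0 ?sqrtr_ge0.
  - by move=> nu _; rewrite lee_fin mulr_ge0.
  - move: suppS; apply: (@filterS _ _ (ae_filter_ringOfSetsType (leb2 R))) => nu /= Snu _.
    have [Unu|Unu] := pselect (U nu); first by rewrite /w indicE mem_set// mulr1.
    by rewrite Snu// normcE /nsq /= expr0n addr0 sqrtr0 !mul0r.
have w2E : (\int[leb2 R]_nu (w nu ^+ 2)%:E =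
    (s ^+ 2 - erf (Num.sqrt (pi * s ^+ 2 / 4)) ^+ 2)%:E)%E.
  rewrite -integral_centered_square_defect//.
  rewrite -(ge0_integral_measure_preserving2 mp (measurable_centered_square s)
    (F := fun z => (D z)%:E)); last 2 first.
  - exact/measurable_EFinP.
  - by move=> z; rewrite lee_fin.
  rewrite -UE [RHS]integral_mkcond; apply: eq_integral => nu _.
  rewrite patchE /w indicE; case: (nu \in U); last by rewrite mulr0 expr0n.
  by rewrite mulr1 sqr_sqrtr//; exact: D0.
(* Conjugacy gives 1 / b = 1 - 1 / a, which lies in (0, 1]; [a = +oo] corresponds to [b = 1]. *)
have b1 : 1 <= b.
  have a0 : (0 < a)%E by exact: lt_trans a_gt1.
  case: a a_gt1 ab a0 {Sfin} => [r| |]// r1; last first.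
    by rewrite invey add0e => -[bE] _; rewrite -(invrK b) bE invr1.
  move: r1; rewrite lte_fin => r1 abE; rewrite lte_fin => r0; move: abE.
  rewrite inver gt_eqF// -EFinD => -[abE].
  have bV0 : 0 < b^-1 by rewrite -(ltrD2l r^-1) abE addr0 invf_lt1.
  rewrite -[b]invrK invf_ge1// -(lerD2l r^-1) abE lerDr invr_ge0 ltW//.
have muT : (0 < leb2 R setT)%E.
  by apply: lt_le_trans U_gt0 _; apply: le_measure; rewrite ?inE.
have Fw_le := ge0_hoelder a_gt1 ab muT mF mw F0 w0.
have wU nu : ~ U nu -> w nu = 0 by move=> Unu; rewrite /w indicE memNset// mulr0.
have w_le := Lnorm_le_max2 b1 mU U_le1 mw w01 wU.
rewrite w2E poweR_EFin in w_le.
have X_le : (\int[leb2 R]_nu (ComplexField.Normc.normc (Sigma nu) * Num.sqrt (W nu))%:E <=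
    cLnorm (leb2 R) a Sigma *
    ((s ^+ 2 - erf (Num.sqrt (pi * s ^+ 2 / 4)) ^+ 2) `^ (Num.max b 2)^-1)%:E)%E.
  by rewrite FwE (le_trans Fw_le)// lee_wpmul2l// Lnorm_ge0.
have X_lt : (\int[leb2 R]_nu (ComplexField.Normc.normc (Sigma nu) * Num.sqrt (W nu))%:E < +oo)%E.
  by apply: le_lt_trans X_le _; rewrite muleC lte_mul_pinfty// lee_fin powR_ge0.
apply: le_trans X_le; apply: (channel_residual_bound chan).
- exact: L2_tfshift.
- exact: L2_tfshift.
- by rewrite nsq2_tfshift.
- by rewrite nsq2_tfshift.
(* The lower bound of [chirp_overlap] is free of [mu0], here instantiated with [mu], so the weight
   [W] is the same for every [mu]. *)
- by move=> nu; rewrite /W /D lerD2l lerN2 /= -formE; exact: chirp_overlap.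
- exact: measurable_funM.
- exact: X_lt.
Qed.
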